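(* Let $\mu$ be a measure, $L_1=L_1(\mu)$, and let $X$ be an $n$-dimensional subspace of $L_1$ for which $C_{1,p^*}(X)\le C\sqrt{p^*}$ for all $2\le p^*<\infty$. Let $j$ be the inclusion map from $X$ into $L_1$, and suppose $j=UW$ with linear operators $W\colon X\to Z$, $U\colon Z\to L_1$, where $\|W\|\le 1$ and $Z$ is an $L_1$ space. Then $$\gamma_U(l_1^k)\le 5^{2D}\quad\text{for some integer } k\ge 5^{-2D}\,2^{n/(2D)},$$ where $D=(2^8C\|U\|)^2$.
   Context: For $1\le p<q\le\infty$ and an operator $u\colon Z\to L_p(\mu)$, $C_{p,q}(u)=\inf\{\|h\|_s\,\|h^{-1}u\colon Z\to L_q(\mu)\|\}$, the infimum being over all changes of measure $0<h\in L_s(\mu)$, where $\frac1q+\frac1s=\frac1p$ (convention $0/0=0$, so $h$ may vanish where all $uz$ vanish). For a subspace $X\subset L_p(\mu)$, $C_{p,q}(X)$ denotes $C_{p,q}$ of the inclusion map $X\to L_p(\mu)$. For linear operators $T\colon X\to Y$ and $V\colon X_1\to Y_1$, $\gamma_T(V)=\inf\{\|A\|\|B\| : A\colon X_1\to X,\ B\colon Y\to Y_1,\ V=BTA\}$ (with $\gamma_T(V)=\infty$ if no such factorization exists), and for a Banach space $E$, $\gamma_T(E)=\gamma_T(\mathrm{id}_E)$. ''An $L_1$ space'' means a space $L_1(\nu)$ for some measure $\nu$. *)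

(* Defs.v *)
From HB Require Import structures.
From mathcomp Require Import all_boot all_order all_algebra.
From mathcomp Require Import all_classical all_reals all_analysis.
From mathcomp Require Import measurable_realfun ess_sup_inf.

Set Implicit Arguments.
Unset Strict Implicit.
Unset Printing Implicit Defensive.

Import Order.TTheory GRing.Theory Num.Theory.
Import numFieldNormedType.Exports.

Local Open Scope classical_set_scope.
Local Open Scope ring_scope.

(* L_p(mu) as a normed space: the linear structure and the norm 'N[mu]_p on the
   type LspaceType of classes of functions modulo mu-a.e. equality, which the
   library leaves without algebraic structure. *)
Section LspaceNormed.
Context d (T : measurableType d) (R : realType).
Variables (mu : {measure set T -> \bar R}) (p : \bar R) (p1 : (1 <= p)%E).
Local Notation Lp := (LspaceType mu p1).
Implicit Types f g h : Lp.

HB.instance Definition _ := gen_eqMixin Lp.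
HB.instance Definition _ := gen_choiceMixin Lp.

Definition Lspace_fun f : T -> R := aqEqMfun_to_fun (LebesgueSpace.sort f).

Lemma Lspace_measurable f : measurable_fun setT (Lspace_fun f).
Proof. exact: (@measurable_funPT _ _ _ _ (repr (LebesgueSpace.sort f))). Qed.

Lemma Lspace_Lfun f : Lspace_fun f \in Lfun mu p.
Proof.
rewrite inE; apply/andP; split; rewrite inE/=; first exact: Lspace_measurable.
exact: (@Lebesgue_finite _ _ _ _ _ _ f).
Qed.

Definition Lspace_repr f : LfunType mu p1 := Lfun_Sub p1 (Lspace_Lfun f).

Lemma eq_Lspace f g : Lspace_fun f = Lspace_fun g %[ae mu] -> f = g.
Proof.
case: f g => [f [[f_fin]]] [g [[g_fin]]] fg.
have /eqP : f == g by rewrite -[f]reprK -[g]reprK; apply/ae_eqP; exact: fg.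
move=> eq_fg; rewrite eq_fg in f_fin fg *.
by rewrite (bool_irrelevance f_fin g_fin).
Qed.

Lemma eq_ae_Lnorm (u v : T -> R) : measurable_fun setT u ->
  measurable_fun setT v -> u = v %[ae mu] ->
  ('N[mu]_p[EFin \o u] = 'N[mu]_p[EFin \o v])%E.
Proof.
move=> mu_ mv uv; rewrite unlock; case: p p1 => [r r1|_|//] /=.
  congr (_ `^ _)%E; apply: ae_eq_integral => //.
  - apply/measurable_EFinP/(measurableT_comp (measurable_powR _)).
    exact: measurableT_comp.
  - apply/measurable_EFinP/(measurableT_comp (measurable_powR _)).
    exact: measurableT_comp.
  - by apply: filterS uv => x /(_ I) uvx _; rewrite /= uvx.
case: ifPn => // _; apply: eq_ess_sup.
by apply: filterS uv => x /(_ I) uvx; rewrite /= uvx.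
Qed.

Section of_Lfun.
Variable u : LfunType mu p1.

Let u_meas : measurable_fun setT (u : T -> R).
Proof. exact: measurable_funPT. Qed.

Let u' : {mfun T >-> measurableTypeR R} :=
  HB.pack_for {mfun T >-> measurableTypeR R} (u : T -> measurableTypeR R)
    (@isMeasurableFun.Build _ _ _ (measurableTypeR R)
      (u : T -> measurableTypeR R) u_meas).

Let Q := {mfun_ mu, T >-> measurableTypeR R}.

Let q : Q := \pi_Q%qT u'.

Let qE : aqEqMfun_to_fun q = u %[ae mu].
Proof.
have /eqP : q = \pi_Q%qT (repr q) by rewrite reprK.
by rewrite eqmodE /= => /asboolP/ae_eq_sym.
Qed.

Let q_fin : finite_norm mu p (aqEqMfun_to_fun q).
Proof.
rewrite /finite_norm (eq_ae_Lnorm _ u_meas qE); first exact: Lfunction_finite.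
exact: (@measurable_funPT _ _ _ _ (repr q)).
Qed.

Definition Lspace_of : Lp :=
  LebesgueSpace.Pack (LebesgueSpace.Class
    (@isFinLebesgue.Axioms_ _ _ _ _ _ p1 q q_fin)).

Lemma Lspace_ofE : Lspace_fun Lspace_of = u %[ae mu].
Proof. exact: qE. Qed.
End of_Lfun.

Let add f g := Lspace_of (Lspace_repr f + Lspace_repr g).
Let opp f := Lspace_of (- Lspace_repr f).
Let scale (a : R) f := Lspace_of (a *: Lspace_repr f).
Let zero : Lp := Lspace_of 0.

Let addE f g : Lspace_fun (add f g) = (Lspace_fun f \+ Lspace_fun g) %[ae mu].
Proof. exact: Lspace_ofE. Qed.

Let oppE f : Lspace_fun (opp f) = (\- Lspace_fun f) %[ae mu].
Proof. exact: Lspace_ofE. Qed.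

Let scaleE a f : Lspace_fun (scale a f) = (a \*: Lspace_fun f) %[ae mu].
Proof. exact: Lspace_ofE. Qed.

Let zeroE : Lspace_fun zero = cst 0 %[ae mu].
Proof. exact: Lspace_ofE. Qed.

Let addA : associative add.
Proof.
move=> f g h; apply: eq_Lspace.
apply: filterS (filterI (addE f (add g h)) (filterI (addE (add f g) h)
  (filterI (addE f g) (addE g h))))
  => x [/(_ I) /= E1 [/(_ I) /= E2 [/(_ I) /= E3 /(_ I) /= E4]]] _ /=.
by rewrite E1 E2 E3 E4 ?addrA.
Qed.

Let addC : commutative add.
Proof.
move=> f g; apply: eq_Lspace.
apply: filterS (filterI (addE f g) (addE g f))
  => x [/(_ I) /= E1 /(_ I) /= E2] _ /=.
by rewrite E1 E2 addrC.
Qed.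

Let add0 : left_id zero add.
Proof.
move=> f; apply: eq_Lspace.
apply: filterS (filterI (addE zero f) (zeroE))
  => x [/(_ I) /= E1 /(_ I) /= E2] _ /=.
by rewrite E1 E2 add0r.
Qed.

Let addN : left_inverse zero opp add.
Proof.
move=> f; apply: eq_Lspace.
apply: filterS (filterI (addE (opp f) f) (filterI (oppE f) (zeroE)))
  => x [/(_ I) /= E1 [/(_ I) /= E2 /(_ I) /= E3]] _ /=.
by rewrite E1 E2 E3 addNr.
Qed.

HB.instance Definition _ := GRing.isZmodule.Build Lp addA addC add0 addN.

Let scaleA a b f : scale a (scale b f) = scale (a * b) f.
Proof.
apply: eq_Lspace.
apply: filterS (filterI (scaleE a (scale b f))
  (filterI (scaleE b f) (scaleE (a * b) f)))
  => x [/(_ I) /= E1 [/(_ I) /= E2 /(_ I) /= E3]] _ /=.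
by rewrite E1 E2 E3 scalerA.
Qed.

Let scale1 : left_id 1 scale.
Proof.
move=> f; apply: eq_Lspace.
apply: filterS (scaleE 1 f) => x /(_ I) /= E1 _ /=.
by rewrite E1 scale1r.
Qed.

Let scaleDr : right_distributive scale +%R.
Proof.
move=> a f g; apply: eq_Lspace.
apply: filterS (filterI (scaleE a (add f g)) (filterI (addE f g)
  (filterI (addE (scale a f) (scale a g))
  (filterI (scaleE a f) (scaleE a g)))))
  => x [/(_ I) /= E1 [/(_ I) /= E2 [/(_ I) /= E3
    [/(_ I) /= E4 /(_ I) /= E5]]]] _ /=.
by rewrite E1 E2 E3 E4 E5 scalerDr.
Qed.

Let scaleDl f : {morph scale^~ f : a b / a + b}.
Proof.
move=> a b; apply: eq_Lspace.
apply: filterS (filterI (scaleE (a + b) f)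
  (filterI (addE (scale a f) (scale b f))
  (filterI (scaleE a f) (scaleE b f))))
  => x [/(_ I) /= E1 [/(_ I) /= E2 [/(_ I) /= E3 /(_ I) /= E4]]] _ /=.
by rewrite E1 E2 E3 E4 scalerDl.
Qed.

HB.instance Definition _ :=
  GRing.Zmodule_isLmodule.Build R Lp scaleA scale1 scaleDr scaleDl.

Lemma LspaceD f g :
  Lspace_fun (f + g) = (Lspace_fun f \+ Lspace_fun g) %[ae mu].
Proof. exact: addE. Qed.

Lemma LspaceZ a f : Lspace_fun (a *: f) = (a \*: Lspace_fun f) %[ae mu].
Proof. exact: scaleE. Qed.

Lemma Lspace0 : Lspace_fun 0 = cst 0 %[ae mu].
Proof. exact: zeroE. Qed.

Let norm f : R := fine ('N[mu]_p[EFin \o Lspace_fun f]).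

Let norm_ofE (u : LfunType mu p1) f : Lspace_fun f = u %[ae mu] ->
  norm f = fine ('N[mu]_p[EFin \o u]).
Proof.
move=> fu; rewrite /norm (eq_ae_Lnorm _ _ fu)//; exact: Lspace_measurable.
Qed.

Let norm_D f g : norm (f + g) <= norm f + norm g.
Proof.
rewrite (norm_ofE (u := Lspace_repr f + Lspace_repr g)); last exact: LspaceD.
exact: (ler_LnormD (Lspace_repr f) (Lspace_repr g)).
Qed.

Let norm_Z a f : norm (a *: f) = `|a| * norm f.
Proof.
rewrite (norm_ofE (u := a *: Lspace_repr f)); last exact: LspaceZ.
rewrite (LnormZ (Lspace_repr f) a) fineM//.
by rewrite -(finite_norm_fine (Lspace_repr f)).
Qed.

Let norm_eq0 f : norm f = 0 -> f = 0.
Proof.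
move=> f0; apply: eq_Lspace.
apply: ae_eq_trans (ae_eq_sym Lspace0).
exact: (fine_Lnormr_eq0 (f := Lspace_repr f)).
Qed.

HB.instance Definition _ :=
  @Lmodule_isNormed.Build R Lp norm norm_D norm_Z norm_eq0.

Lemma Lspace_normE f : (`|f|)%:E = ('N[mu]_p[EFin \o Lspace_fun f])%E.
Proof. exact: (finite_norm_fine (Lspace_repr f)). Qed.

End LspaceNormed.

(* A linear subspace S of V as a normed space of its own; \val is the inclusion
   map into V. *)
Section NormedSubspace.
Context (R : realType) (V : normedModType R) (S : submodClosed V).

Record normed_subspace := NormedSubspace { incl :> V; _ : incl \in S }.

HB.instance Definition _ := [isSub for incl].
HB.instance Definition _ := [Choice of normed_subspace by <:].
HB.instance Definition _ := [SubChoice_isSubLmodule of normed_subspace by <:].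

Let norm (x : normed_subspace) : R := `|incl x|.

Let norm_D x y : norm (x + y) <= norm x + norm y.
Proof. exact: ler_normD. Qed.

Let norm_Z a x : norm (a *: x) = `|a| * norm x.
Proof. exact: normrZ. Qed.

Let norm_eq0 x : norm x = 0 -> x = 0.
Proof. by move=> /normr0_eq0 x0; exact: val_inj. Qed.

HB.instance Definition _ :=
  @Lmodule_isNormed.Build R normed_subspace norm norm_D norm_Z norm_eq0.

End NormedSubspace.

(* l_1^k: an alias of 'rV[R]_k, which itself carries the sup norm. *)
Section Ell1.
Context (R : realType) (k : nat).

Definition ell1 : Type := 'rV[R]_k.

HB.instance Definition _ := GRing.Lmodule.on ell1.

Let norm (x : ell1) : R := \sum_(i < k) `|x ord0 i|.

Let norm_D x y : norm (x + y) <= norm x + norm y.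
Proof.
by rewrite -big_split; apply: ler_sum => i _; rewrite mxE; exact: ler_normD.
Qed.

Let norm_Z a x : norm (a *: x) = `|a| * norm x.
Proof. by rewrite mulr_sumr; apply: eq_bigr => i _; rewrite mxE normrM. Qed.

Let norm_eq0 x : norm x = 0 -> x = 0.
Proof.
move=> x0; apply/rowP => i; rewrite mxE; apply/normr0_eq0/eqP.
have /eqP := x0; rewrite psumr_eq0// => /allP/(_ i).
by rewrite mem_index_enum => /(_ isT).
Qed.

HB.instance Definition _ :=
  @Lmodule_isNormed.Build R ell1 norm norm_D norm_Z norm_eq0.

Lemma ell1_normE (x : ell1) : `|x| = \sum_(i < k) `|(x : 'rV[R]_k) ord0 i|.
Proof. by []. Qed.

End Ell1.

Section Operators.
Context (R : realType).

Definition opnorm (V W : normedModType R) (u : {linear V -> W}) : \bar R :=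
  ereal_sup [set (`|u x|)%:E | x in [set x | `|x| <= 1]].

(* gamma_T(V); the infimum of the empty set is +oo in \bar R. *)
Definition gamma_op (X Y X1 Y1 : normedModType R)
    (t : {linear X -> Y}) (v : {linear X1 -> Y1}) : \bar R :=
  ereal_inf [set c | exists (A : {linear X1 -> X}) (B : {linear Y -> Y1}),
    [/\ continuous A, continuous B, v =1 B \o t \o A &
        c = (opnorm A * opnorm B)%E]].

Definition gamma_space (X Y : normedModType R) (t : {linear X -> Y})
    (E : normedModType R) : \bar R :=
  gamma_op t (@idfun E).

End Operators.

Section ChangeOfMeasure.
Context d (T : measurableType d) (R : realType).
Context (mu : {measure set T -> \bar R}) (p : \bar R) (p1 : (1 <= p)%E).

(* The norm of h^-1 u as an operator into L_q(mu), +oo if it is unbounded or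
   not L_q-valued. Since 0^-1 = 0 in R, the quotient 0/0 is 0. *)
Definition weighted_opnorm (q : \bar R) (Z : normedModType R)
    (u : {linear Z -> LspaceType mu p1}) (h : T -> R) : \bar R :=
  ereal_sup [set ('N[mu]_q[EFin \o (fun x => (h x)^-1 * u z x)%R])%E
            | z in [set z | `|z| <= 1]].

(* h may vanish, but only where, up to a null set, every u z vanishes. *)
Definition change_const (q : \bar R) (Z : normedModType R)
    (u : {linear Z -> LspaceType mu p1}) : \bar R :=
  ereal_inf [set c | exists (s : \bar R) (h : T -> R),
    [/\ (q^-1 + s^-1 = p^-1)%E,
        h \in Lfun mu s,
        (forall x, 0 <= h x),
        (forall z, {ae mu, forall x, h x = 0 -> u z x = 0}) &
        c = ('N[mu]_s[EFin \o h] * weighted_opnorm q u h)%E]].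

Definition change_const_subspace (q : \bar R)
    (X : submodClosed (LspaceType mu p1)) : \bar R :=
  change_const q (\val : {linear normed_subspace X -> LspaceType mu p1}).

End ChangeOfMeasure.

(* Main.v *)
From HB Require Import structures.
Require Import Defs.
From mathcomp Require Import all_boot all_order all_algebra.
From mathcomp Require Import all_classical all_reals all_analysis.
From mathcomp Require Import measurable_realfun zify ring lra.

Set Implicit Arguments.
Unset Strict Implicit.
Unset Printing Implicit Defensive.

Import Order.TTheory GRing.Theory Num.Theory.
Import numFieldNormedType.Exports.

Local Open Scope classical_set_scope.
Local Open Scope ring_scope.

(* Choose Q slightly larger than n / 2D and a density phi that is good for the
   exponents 4 and Q at once, and let x_1, ..., x_n be an orthonormal basis of X
   for <x, y> = int x y / phi. Replace W by a map into the span of finitely many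
   normalized indicators e_l, and write f_l = U e_l, M = 2^Q. Remove greedily
   disjoint sets A_i on which some |f_l| >= M phi has mass at least delta, where
   delta is of order 1 / C^2.

   If one can remove about M sets (up to powers of C and |U|), the corresponding
   e_l, tested against sign(f_l) on the A_i, give a matrix with large diagonal
   and bounded rows; a sparse subset of indices makes it diagonally dominant,
   hence l_1^k factors through U.

   Otherwise U is, up to an error that is small in L_1, given by functions v_l
   with |v_l| <= M phi. Then n = sum_i <x_i, x_i> is essentially
   sum_i <x_i, V W x_i> = sum_l int (sum_i w_il x_i) v_l / phi. The norm of v_l in
   L_{Q*} is at most 2 |U| since M^{1/Q} = 2, the L_Q norm of an element of X
   is at most C sqrt Q times its norm, and sum_l |(w_il)_i|_2 is at most of order
   sqrt n by Khintchine. This bounds n by a multiple of C |U| sqrt(Q n),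
   contradicting the choice of Q. The exponent 4 is only used to discard the set
   where sum_i (x_i / phi)^2 exceeds a multiple of n, so that the L_1 error can
   be paired with the x_i / phi. *)

(** * Sign averages and orthonormal bases *)

(** The signs live on a finite sample space, so that averages over them are finite sums; a new
    independent sign is added by doubling the space. *)
Lemma rademacher_system (R : realFieldType) (n : nat) :
  exists (Om : finType) (r : Om -> nat -> R),
  [/\ (0 < #|Om|)%N, forall om i, r om i ^+ 2 = 1,
      forall b : nat -> R, \sum_om (\sum_(i < n) r om i * b i) ^+ 2 =
        #|Om|%:R * \sum_(i < n) b i ^+ 2 &
      forall b : nat -> R, \sum_om (\sum_(i < n) r om i * b i) ^+ 4 <=
        3 * #|Om|%:R * (\sum_(i < n) b i ^+ 2) ^+ 2].
Proof.
elim: n => [|n [Om [r [Om0 r1 r2 r4]]]].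
  exists unit, (fun _ _ => 1); split => [|//=|b|b]; first by rewrite card_unit.
    by rewrite expr1n.
    by rewrite big1 => [|om _]; rewrite !big_ord0 ?mulr0 ?expr0n.
  by rewrite big1 => [|om _]; rewrite !big_ord0 !expr0n//= mulr0.
pose r' (om : bool * Om) i : R := if i == n then (-1) ^+ om.1 else r om.2 i.
have sumE (b : nat -> R) om : \sum_(i < n.+1) r' om i * b i =
    \sum_(i < n) r om.2 i * b i + (-1) ^+ om.1 * b n.
  rewrite big_ord_recr/= {2}/r' eqxx; congr (_ + _); apply: eq_bigr => i _.
  by rewrite /r' ltn_eqF.
have sum_pair (F : R -> R) (b : nat -> R) :
    \sum_om F (\sum_(i < n.+1) r' om i * b i) =
    \sum_om (F (\sum_(i < n) r om i * b i + b n) +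
             F (\sum_(i < n) r om i * b i - b n)).
  under eq_bigr do rewrite sumE.
  rewrite -(pair_bigA _ (fun (e : bool) om => F (\sum_(i < n) r om i * b i + (-1) ^+ e * b n)))/=.
  rewrite big_bool/= big_split/= addrC; congr (_ + _); apply: eq_bigr => om _.
    by rewrite expr0 mul1r.
  by rewrite expr1 mulN1r.
exists (bool * Om)%type, r'; split => [|om i|b|b].
- by rewrite card_prod card_bool muln_gt0.
- by rewrite /r'; case: ifP => _ //; rewrite sqrr_sign.
- rewrite (sum_pair (fun x => x ^+ 2)) card_prod card_bool natrM big_ord_recr/=.
  under eq_bigr => om _ do (have -> : forall x y : R,
    (x + y) ^+ 2 + (x - y) ^+ 2 = 2 * x ^+ 2 + 2 * y ^+ 2 by move=> x y; ring).
  by rewrite big_split/= -mulr_sumr r2 sumr_const -[_ *+ #|_|]mulr_natl; ring.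
- rewrite (sum_pair (fun x => x ^+ 4)) card_prod card_bool natrM big_ord_recr/=.
  under eq_bigr => om _ do (have -> : forall x y : R,
    (x + y) ^+ 4 + (x - y) ^+ 4 = 2 * x ^+ 4 + 12 * y ^+ 2 * x ^+ 2 + 2 * y ^+ 4
      by move=> x y; ring).
  rewrite !big_split/= -!mulr_sumr r2 sumr_const -[_ *+ #|_|]mulr_natl.
  have := r4 b; set S4 := \sum_om _; set s2 := \sum_(i < n) _ => h4.
  have : 0 <= #|Om|%:R * b n ^+ 4 by rewrite mulr_ge0// exprn_even_ge0.
  (* The constant 3 survives the induction: 6 s2^2 + 12 b_n^2 s2 + 2 b_n^4 is at most 6 (s2 +
     b_n^2)^2, with slack 4 b_n^4. *)
  have -> : 3 * (2%:R * #|Om|%:R) * (s2 + b n ^+ 2) ^+ 2 =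
    2 * (3 * #|Om|%:R * s2 ^+ 2) + 12 * b n ^+ 2 * (#|Om|%:R * s2) +
    6 * (#|Om|%:R * b n ^+ 4) by ring.
  by move: h4; lra.
Qed.

(* The average of the tangent inequality [3 s^2 S^2 <= 2 s^3 |S| + S^4], with s
   twice the square root of the second moment. *)
Lemma khintchine_L1 (R : rcfType) (n : nat) (Om : finType)
    (r : Om -> nat -> R) (b : nat -> R) :
  \sum_om (\sum_(i < n) r om i * b i) ^+ 2 = #|Om|%:R * \sum_(i < n) b i ^+ 2 ->
  \sum_om (\sum_(i < n) r om i * b i) ^+ 4 <=
    3 * #|Om|%:R * (\sum_(i < n) b i ^+ 2) ^+ 2 ->
  #|Om|%:R * Num.sqrt (\sum_(i < n) b i ^+ 2) <=
    2 * \sum_om `|\sum_(i < n) r om i * b i|.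
Proof.
move=> h2 h4.
set s : R := Num.sqrt _.
have s0 : 0 <= s by exact: sqrtr_ge0.
have s2E : \sum_(i < n) b i ^+ 2 = s ^+ 2.
  by rewrite sqr_sqrtr// sumr_ge0// => i _; exact: sqr_ge0.
have [->|s_neq0] := eqVneq s 0.
  by rewrite mulr0; apply: mulr_ge0 => //; rewrite sumr_ge0.
have {s_neq0}s_gt0 : 0 < s by rewrite lt_def s_neq0.
have tangent x : 12 * s ^+ 2 * x ^+ 2 <= 16 * s ^+ 3 * `|x| + x ^+ 4.
  have -> : x ^+ 2 = `|x| ^+ 2 by rewrite real_normK ?num_real.
  have -> : x ^+ 4 = `|x| ^+ 4.
    by rewrite -normrX ger0_norm// exprn_even_ge0.
  rewrite -subr_ge0.
  have -> : 16 * s ^+ 3 * `|x| + `|x| ^+ 4 - 12 * s ^+ 2 * `|x| ^+ 2 =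
     `|x| * (`|x| - 2 * s) ^+ 2 * (`|x| + 4 * s) by ring.
  apply: mulr_ge0; first by apply: mulr_ge0 => //; exact: sqr_ge0.
  by apply: addr_ge0 => //; apply: mulr_ge0.
have : \sum_om (12 * s ^+ 2 * (\sum_(i < n) r om i * b i) ^+ 2) <=
    \sum_om (16 * s ^+ 3 * `|\sum_(i < n) r om i * b i| +
             (\sum_(i < n) r om i * b i) ^+ 4).
  by apply: ler_sum => om _; exact: tangent.
rewrite big_split/= -!mulr_sumr h2 s2E.
move: h4; rewrite s2E; set S4 := \sum_om _ ^+ 4; set S1 := \sum_om _ => h4 h.
have s3 : 0 < s ^+ 3 by rewrite exprn_gt0.
(* The fourth moment uses up 3 s^4 of the 12 s^4; the remaining ratio 16 / 9 is below 2. *)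
have : 9 * (s ^+ 3 * (#|Om|%:R * s)) <= 16 * (s ^+ 3 * S1).
  have -> : 9 * (s ^+ 3 * (#|Om|%:R * s)) =
    12 * s ^+ 2 * (#|Om|%:R * s ^+ 2) - 3 * #|Om|%:R * (s ^+ 2) ^+ 2 by ring.
  by rewrite lerBlDr (le_trans h)// mulrA lerD2l.
rewrite mulrCA [leRHS]mulrCA ler_pM2l// => h9.
have : 0 <= S1 by rewrite sumr_ge0.
by move: h9; lra.
Qed.

(** Cauchy-Schwarz, by summing (s a_i - al b_i)^2 >= 0 with s the norm of b; [al] is any upper bound
    for the norm of a. *)
Lemma sum_mul_le_norm2 (R : rcfType) (I : finType) (a b : I -> R) (al : R) :
  0 < al -> \sum_i a i ^+ 2 <= al ^+ 2 ->
  \sum_i a i * b i <= al * Num.sqrt (\sum_i b i ^+ 2).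
Proof.
move=> al0 ha; set s := Num.sqrt _.
have s0 : 0 <= s by exact: sqrtr_ge0.
have b0 : 0 <= \sum_i b i ^+ 2 by rewrite sumr_ge0// => i _; exact: sqr_ge0.
have s2E : \sum_i b i ^+ 2 = s ^+ 2 by rewrite sqr_sqrtr.
have [s_eq0|s_neq0] := eqVneq s 0.
  rewrite s_eq0 mulr0 big1// => i _.
  have /eqP : \sum_i b i ^+ 2 = 0 by rewrite s2E s_eq0 expr0n.
  rewrite psumr_eq0; last by move=> j _; exact: sqr_ge0.
  move=> /allP/(_ i); rewrite mem_index_enum sqrf_eq0 => /(_ isT) /eqP ->.
  by rewrite mulr0.
have {s_neq0}s_gt0 : 0 < s by rewrite lt_def s_neq0.
have amgm i : 2 * (al * s) * (a i * b i) <= s ^+ 2 * a i ^+ 2 + al ^+ 2 * b i ^+ 2.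
  rewrite -subr_ge0.
  have -> : s ^+ 2 * a i ^+ 2 + al ^+ 2 * b i ^+ 2 - 2 * (al * s) * (a i * b i) =
    (s * a i - al * b i) ^+ 2 by ring.
  exact: sqr_ge0.
have : \sum_i 2 * (al * s) * (a i * b i) <=
    \sum_i (s ^+ 2 * a i ^+ 2 + al ^+ 2 * b i ^+ 2) by exact: ler_sum.
rewrite big_split/= -!mulr_sumr s2E => h.
have als : 0 < 2 * (al * s) by rewrite !mulr_gt0.
rewrite -(ler_pM2l als) (le_trans h)//.
have -> : 2 * (al * s) * (al * s) = s ^+ 2 * al ^+ 2 + al ^+ 2 * s ^+ 2 by ring.
by rewrite lerD2r ler_wpM2l// sqr_ge0.
Qed.

(** Rather than subtracting projections, each step normalizes a nonzero vector in the common kernel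
    of the functionals B(x_j, .); in coordinates these are the k < n columns of [A], so the kernel
    is not trivial. *)
Lemma exists_orthonormal (R : rcfType) (n : nat) (V : lmodType R)
    (dimV : Vector.axiom n V) (B : V -> V -> R) :
  (forall x a y z, B x (a *: y + z) = a * B x y + B x z) ->
  (forall x y, B x y = B y x) ->
  (forall x, x != 0 -> 0 < B x x) ->
  exists x : 'I_n -> V, forall i j, B (x i) (x j) = (i == j)%:R.
Proof.
move=> Blin Bsym Bpos.
have Bx0 x : B x 0 = 0.
  by have := Blin x 1 0 0; rewrite scaler0 addr0 mul1r => /eqP; rewrite -subr_eq0 opprD addNKr oppr_eq0 => /eqP.
have BZ x a y : B x (a *: y) = a * B x y by rewrite -[a *: y]addr0 Blin Bx0 addr0.
have BZZ x a y : B (a *: x) (a *: y) = a ^+ 2 * B x y by rewrite BZ Bsym BZ Bsym mulrA.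
have [v2r v2r_lin [r2v v2rK r2vK]] := dimV.
have r2v0 (c : 'rV[R]_n) : r2v c = 0 -> c = 0.
  move=> c0; rewrite -[c]r2vK c0; have := v2r_lin 1 0 0.
  by rewrite !scale1r !addr0 => /eqP; rewrite -subr_eq0 opprD addNKr oppr_eq0 => /eqP.
have r2v_lin a c c' : r2v (a *: c + c') = a *: r2v c + r2v c'.
  by apply: (can_inj v2rK); rewrite r2vK v2r_lin !r2vK.
have r2v_sum k (F : 'I_k -> R) (c : 'I_k -> 'rV[R]_n) x :
    B x (r2v (\sum_i F i *: c i)) = \sum_i F i * B x (r2v (c i)).
  have r2v00 : r2v 0 = 0.
    apply: (can_inj v2rK); rewrite r2vK; have := v2r_lin 1 0 0.
    by rewrite !scale1r !addr0 => /eqP; rewrite -subr_eq0 opprD addNKr oppr_eq0 => /eqP.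
  elim/big_rec2: _ => [|i y1 y2 _ <-]; first by rewrite r2v00 Bx0.
  by rewrite r2v_lin Blin.
suff [x xon] : exists x : nat -> V, forall i j, (i < n)%N -> (j < n)%N ->
    B (x i) (x j) = (i == j)%:R.
  by exists (fun i => x i) => i j; rewrite xon.
suff /(_ _ (leqnn n)) : forall k, (k <= n)%N -> exists x : nat -> V,
  forall i j, (i < k)%N -> (j < k)%N -> B (x i) (x j) = (i == j)%:R by [].
elim=> [_|k IH kn]; first by exists (fun=> 0) => i j.
have [x xon] := IH (ltnW kn).
pose A := \matrix_(i < n, j < k) B (x j) (r2v (delta_mx 0 i)).
have /rowV0Pn[c /sub_kermxP cA c0] : kermx A != 0.
  rewrite -mxrank_eq0 mxrank_ker subn_eq0 -ltnNge.
  exact: leq_ltn_trans (rank_leq_col A) kn.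
pose y := r2v c.
have y0 : y != 0 by apply: contra c0 => /eqP/r2v0 ->.
have yx i : (i < k)%N -> B (x i) y = 0.
  move=> ik; have /rowP/(_ (Ordinal ik)) := cA; rewrite !mxE => <-.
  rewrite /y [c in LHS]row_sum_delta r2v_sum; apply: eq_bigr => j _.
  by rewrite mxE.
pose z := (Num.sqrt (B y y))^-1 *: y.
have zz : B z z = 1.
  rewrite BZZ exprVn sqr_sqrtr; last exact/ltW/Bpos.
  by rewrite mulVf// gt_eqF// Bpos.
have zx i : (i < k)%N -> B (x i) z = 0 by move=> ik; rewrite BZ yx// mulr0.
exists (fun i => if i == k then z else x i) => i j.
rewrite !ltnS [(i <= k)%N]leq_eqVlt [(j <= k)%N]leq_eqVlt.
case: eqVneq => [->|ik] /=; case: eqVneq => [->|jk] //=.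
- by move=> _ jk'; rewrite Bsym zx.
- by move=> ik' _; rewrite zx// (negPf ik).
- by move=> ik' jk'; exact: xon.
Qed.

(** * Diagonally dominant submatrices *)

Lemma exists_le_average (R : realFieldType) (r : nat) (F : 'I_r.+1 -> R) :
  exists t, r.+1%:R * F t <= \sum_t F t.
Proof.
apply: contrapT => /forallNP noF.
have : \sum_t (r.+1%:R * F t) <= \sum_(t < r.+1) \sum_t F t.
  by rewrite -mulr_sumr sumr_const card_ord mulr_natl.
apply/negP; rewrite -ltNge; apply: ltr_sum => [|t _].
  by apply/hasP; exists ord0 => //; rewrite mem_index_enum.
by have /negP := noF t; rewrite -ltNge.
Qed.

(* Colour the points one by one, each time with the cheapest colour. *)
Lemma exists_sparse_coloring (R : realFieldType) (r m : nat)
    (a : nat -> nat -> R) :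
  (forall i, a i i = 0) ->
  exists c : nat -> 'I_r.+1,
    r.+1%:R * (\sum_(i < m) \sum_(j < m) (c i == c j)%:R * a i j) <=
    \sum_(i < m) \sum_(j < m) a i j.
Proof.
move=> a0.
have step (g : nat -> nat -> R) k : (forall i, g i i = 0) ->
    \sum_(i < k.+1) \sum_(j < k.+1) g i j =
    \sum_(i < k) \sum_(j < k) g i j + \sum_(j < k) (g k j + g j k).
  move=> g0; rewrite big_ord_recr/= (eq_bigr (fun i : 'I_k =>
    \sum_(j < k) g i j + g i k)) => [|i _]; last by rewrite big_ord_recr.
  by rewrite big_split/= big_ord_recr/= g0 addr0 big_split/= -addrA [X in _ + X]addrC.
elim: m => [|m [c hc]]; first by exists (fun=> ord0); rewrite !big_ord0 mulr0.
have [t ht] := exists_le_average (fun t =>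
  \sum_(j < m) (t == c j)%:R * (a m j + a j m)).
pose c' i := if i == m then t else c i.
have c'E (i : 'I_m) : c' i = c i by rewrite /c' ltn_eqF.
exists c'; rewrite (step a)// (step (fun i j => (c' i == c' j)%:R * a i j)).
  2: by move=> i; rewrite a0 mulr0.
rewrite mulrDr lerD//.
  apply: le_trans hc; rewrite le_eqVlt; apply/orP; left; apply/eqP.
  by congr (_ * _); apply: eq_bigr => i _; apply: eq_bigr => j _; rewrite !c'E.
rewrite (eq_bigr (fun j : 'I_m => (t == c j)%:R * (a m j + a j m))); last first.
  by move=> j _; rewrite c'E /c' eqxx mulrDr [c j == t]eq_sym.
rewrite (le_trans ht)// exchange_big/= ler_sum// => j _.
rewrite -mulr_suml (bigD1 (c j))//= eqxx big1 ?addr0 ?mul1r// => t' t'c.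
by rewrite (negPf t'c).
Qed.

(** In a cheap colouring, Markov's inequality leaves at least half of the rows with a small sum
    inside their own colour class; S consists of the good rows of their most frequent colour. *)
Lemma exists_sparse_subset (R : realFieldType) (r m : nat) (u : R)
    (a : nat -> nat -> R) :
  0 < u -> (forall i j, 0 <= a i j) -> (forall i, a i i = 0) ->
  (forall i : 'I_m, \sum_(j < m) a i j <= u) ->
  exists S : {set 'I_m}, m%:R <= 2 * r.+1%:R * #|S|%:R :> R /\
    forall i, i \in S -> \sum_(j in S) a i j <= 2 * u / r.+1%:R.
Proof.
move=> u0 age0 a0 au.
have [c hc] := exists_sparse_coloring r m a0.
pose row (i : 'I_m) := \sum_(j < m) (c i == c j)%:R * a i j.
pose bound := 2 * u / r.+1%:R.
have r0 : 0 < r.+1%:R :> R by [].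
have bound0 : 0 < bound by rewrite divr_gt0// mulr_gt0.
have row0 i : 0 <= row i by rewrite sumr_ge0// => j _; rewrite mulr_ge0.
pose Good := finset (fun i => row i <= bound).
have GoodE : m%:R <= 2 * #|Good|%:R :> R.
  have : #|~: Good|%:R * bound <= m%:R * u / r.+1%:R.
    rewrite ler_pdivlMr// [leLHS]mulrC (@le_trans _ _ (r.+1%:R * \sum_i row i))//.
      rewrite ler_pM2l// (bigID [in ~: Good])/= ler_wpDr ?sumr_ge0//.
      rewrite mulr_natl -sumr_const ler_sum// => i.
      by rewrite !inE -ltNge => /ltW.
    rewrite (le_trans hc)// mulr_natl -[in leRHS](card_ord m) -sumr_const.
    by rewrite ler_sum.
  have -> : m%:R * u / r.+1%:R = m%:R / 2 * bound by rewrite /bound; field; rewrite ?gt_eqF.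
  rewrite ler_pM2r// -[in m%:R](card_ord m) -(cardsC Good) natrD => h.
  by move: h; lra.
pose cls t := finset (fun i : 'I_m => (i \in Good) && (c i == t)).
(* Averaging minus the cardinality yields a class of at least average size. *)
have [t ht] := exists_le_average (fun t => - #|cls t|%:R : R).
exists (cls t); split.
  rewrite (le_trans GoodE)// -mulrA ler_pM2l//.
  rewrite mulrN sumrN lerN2 in ht; apply: le_trans ht.
  rewrite -natr_sum ler_nat -sum1_card (partition_big (fun i : 'I_m => c i) xpredT)//=.
  apply: leq_sum => t' _; rewrite sum1_card; apply/subset_leq_card/fintype.subsetP => i.
  by rewrite /cls inE.
move=> i; rewrite !inE => /andP[irow /eqP ci]; apply: le_trans irow.
rewrite /row [leRHS](bigID [in cls t])/=.
rewrite ler_wpDr//; first by rewrite sumr_ge0// => j _; rewrite mulr_ge0.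
by apply: ler_sum => j; rewrite !inE => /andP[_ /eqP cj]; rewrite ci cj eqxx mul1r.
Qed.

(** Since z acts from the left, the off-diagonal mass of row i is charged to |z_i|, which costs half
    of the diagonal contribution after summing over the columns. *)
Lemma diag_dominant_l1 (R : realFieldType) (k : nat) (G : 'M[R]_k) (dl : R)
    (z : 'rV[R]_k) :
  (forall i, dl <= G i i) ->
  (forall i, \sum_(j | j != i) `|G i j| <= dl / 2) ->
  dl / 2 * \sum_i `|z 0 i| <= \sum_j `|(z *m G) 0 j|.
Proof.
move=> diagG offG.
have entry j : dl * `|z 0 j| - \sum_(i | i != j) `|z 0 i| * `|G i j| <=
    `|(z *m G) 0 j|.
  rewrite mxE [in leRHS](bigD1 j)//=. apply: le_trans; last apply: lerB_normD. apply: lerB.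
    by rewrite normrM mulrC ler_wpM2l//; apply: le_trans (diagG j) (ler_norm _).
  rewrite (le_trans (ler_norm_sum _ _ _))// ler_sum// => i _.
  by rewrite normrM.
apply: le_trans (ler_sum _ (fun j _ => entry j)).
rewrite sumrB -mulr_sumr.
rewrite (exchange_big_dep xpredT)//=.
have : \sum_i \sum_(j | i != j) `|z 0 i| * `|G i j| <= \sum_i `|z 0 i| * (dl / 2).
  apply: ler_sum => i _; rewrite -mulr_sumr ler_wpM2l//.
  by rewrite (eq_bigl (fun j => j != i)) => [|j]; rewrite ?offG// eq_sym.
by rewrite -mulr_suml; set X := \sum_i \sum_(j | _) _; set Y := \sum_i _; move=> h; lra.
Qed.

Lemma diag_dominant_unitmx (R : realFieldType) (k : nat) (G : 'M[R]_k) (dl : R) :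
  0 < dl -> (forall i, dl <= G i i) ->
  (forall i, \sum_(j | j != i) `|G i j| <= dl / 2) -> G \in unitmx.
Proof.
move=> dl0 diagG offG; rewrite -row_free_unit -kermx_eq0.
apply/rowV0P => z /sub_kermxP zG.
have := diag_dominant_l1 z diagG offG; rewrite zG.
rewrite [leRHS]big1 => [|i _]; last by rewrite mxE normr0.
rewrite pmulr_rle0 ?divr_gt0// => z_le0.
have /eqP : \sum_i `|z 0 i| = 0.
  by apply/eqP; rewrite eq_le z_le0 sumr_ge0.
rewrite psumr_eq0// => /allP z0; apply/rowP => i; rewrite mxE.
by apply/normr0_eq0/eqP/z0; rewrite mem_index_enum.
Qed.

(** * Disjoint peaks *)

Section IntegralBounds.
Context d (T : measurableType d) (R : realType).
Variable mu : {measure set T -> \bar R}.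
Implicit Types (f g : T -> R) (a b : R).

(** Measurability and positivity travel with the bound, so that pointwise estimates can be
    integrated term by term without repeating side conditions. *)
Definition integral_le f b := [/\ measurable_fun setT f, forall x, 0 <= f x &
  (\int[mu]_x (f x)%:E <= b%:E)%E].

Lemma integral_leW f a b : integral_le f a -> a <= b -> integral_le f b.
Proof.
by move=> [mf f0 fa] ab; split=> //; rewrite (le_trans fa)// lee_fin.
Qed.

Lemma integral_le_ae g f b : integral_le f b -> measurable_fun setT g ->
  (forall x, 0 <= g x) -> {ae mu, forall x, g x <= f x} -> integral_le g b.
Proof.
move=> [mf f0 fb] mg g0 gf; split=> //; apply: le_trans fb.
apply: ae_ge0_le_integral => //.
- by move=> x _; rewrite lee_fin.
- exact/measurable_EFinP.
- by move=> x _; rewrite lee_fin.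
- exact/measurable_EFinP.
- by apply: filterS gf => x gfx _; rewrite lee_fin.
Qed.

Lemma integral_leS g f b : integral_le f b -> measurable_fun setT g ->
  (forall x, 0 <= g x) -> (forall x, g x <= f x) -> integral_le g b.
Proof. by move=> fb mg g0 gf; apply: (integral_le_ae fb) => //; exact: aeW. Qed.

Lemma integral_leD f g a b : integral_le f a -> integral_le g b ->
  integral_le (fun x => f x + g x) (a + b).
Proof.
move=> [mf f0 fa] [mg g0 gb]; split.
- exact: measurable_funD.
- by move=> x; rewrite addr_ge0.
- under eq_integral do rewrite EFinD.
  rewrite ge0_integralD//; try (by move=> x _; rewrite lee_fin); try exact/measurable_EFinP.
  by rewrite EFinD leeD.
Qed.

Lemma integral_leZ k f a : 0 <= k -> integral_le f a ->
  integral_le (fun x => k * f x) (k * a).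
Proof.
move=> k0 [mf f0 fa]; split.
- exact: measurable_funM.
- by move=> x; rewrite mulr_ge0.
- under eq_integral do rewrite EFinM.
  rewrite ge0_integralZl_EFin//; try (by move=> x _; rewrite lee_fin); try exact/measurable_EFinP.
  by rewrite EFinM lee_wpmul2l// lee_fin.
Qed.

Lemma integral_le0 : integral_le (fun=> 0) 0.
Proof. by split=> //; rewrite integral0_eq. Qed.

Lemma integral_le_sum (I : Type) (s : seq I) (F : I -> T -> R) (b : I -> R) :
  (forall i, integral_le (F i) (b i)) ->
  integral_le (fun x => \sum_(i <- s) F i x) (\sum_(i <- s) b i).
Proof.
move=> Fb; elim: s => [|i s IH].
  by under [X in integral_le X]eq_fun do rewrite big_nil; rewrite big_nil; exact: integral_le0.
under [X in integral_le X]eq_fun do rewrite big_cons.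
by rewrite big_cons; exact: integral_leD.
Qed.

(** For nonnegative values the inverse is the real power with exponent -1, also at 0, where both are
    0. *)
Lemma measurable_fun_invr f : measurable_fun setT f -> (forall x, 0 <= f x) ->
  measurable_fun setT (fun x => (f x)^-1).
Proof.
move=> mf f0; rewrite (_ : (fun x => _) = (fun x => f x `^ (-1))).
  exact: (measurableT_comp (measurable_powR _)).
by apply/funext => x; rewrite powR_inv1.
Qed.

Lemma measurable_fun_lin (I : Type) (s : seq I) (c : I -> R) (F : I -> T -> R) :
  (forall i, measurable_fun setT (F i)) ->
  measurable_fun setT (fun x => \sum_(i <- s) c i * F i x).
Proof. by move=> mF; apply: measurable_sum => i; exact: measurable_funM. Qed.

Lemma measurable_fun_normr f : measurable_fun setT f ->
  measurable_fun setT (fun x => `|f x|).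
Proof. by move=> mf; exact: measurableT_comp. Qed.

Lemma measurable_set_le f g : measurable_fun setT f -> measurable_fun setT g ->
  measurable [set x | f x <= g x].
Proof.
move=> mf mg; have := measurable_fun_ler mf mg => /(_ measurableT [set true]).
by rewrite setTI; apply.
Qed.

End IntegralBounds.

(** * Greedy removal of pieces of peaks *)

Section Greedy.
Context d (T : measurableType d) (R : realType).
Variable mu : {measure set T -> \bar R}.
Variables (L : finType) (f : L -> T -> R) (phi : T -> R) (M u dl : R).
Hypothesis mphi : measurable_fun setT phi.
Hypothesis phi0 : forall x, 0 <= phi x.
Hypothesis fu : forall l, integral_le mu (fun x => `|f l x|) u.
Hypothesis mf : forall l, measurable_fun setT (f l).
Hypotheses (M0 : 0 < M) (u0 : 0 <= u).

Let peak l := [set x | M * phi x <= `|f l x|].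

Let mpeak l : measurable (peak l).
Proof.
apply: measurable_set_le; first exact: measurable_funM.
exact: measurable_fun_normr.
Qed.

Let massive l A := (dl%:E <= \int[mu]_x (`|f l x| * \1_A x)%:E)%E.

(** Chebyshev: on a peak [phi] is at most |f_l| / M, so each removed piece costs little
    [phi]-mass. *)
Let phi_peak l A : measurable A -> A `<=` peak l ->
  integral_le mu (fun x => phi x * \1_A x) (u / M).
Proof.
move=> mA Al; rewrite [u / M]mulrC.
apply: integral_leS (integral_leZ _ (fu l)) _ _ _.
- by rewrite invr_ge0 ltW.
- by apply: measurable_funM => //; exact: measurable_indic.
- by move=> x; rewrite mulr_ge0.
- move=> x; rewrite indicE; case: (boolP (x \in A)) => [|_].
    by rewrite inE mulr1 => /Al; rewrite /peak/= ler_pdivlMl.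
  by rewrite mulr0 mulr_ge0// invr_ge0 ltW.
Qed.

(* Remove disjoint pieces of the peaks greedily, as long as one of the
   functions keeps mass [dl] on the rest of its peak. *)
Lemma greedy_peaks m :
  (exists (l : nat -> L) (A : nat -> set T), [/\ forall i, measurable (A i),
     forall i j, (i < m)%N -> (j < m)%N -> i != j -> A i `&` A j = set0 &
     forall i, (i < m)%N -> massive (l i) (A i)]) \/
  exists G, [/\ measurable G,
    integral_le mu (fun x => phi x * \1_G x) (m%:R * (u / M)) &
    forall l, integral_le mu (fun x => `|f l x| *
      \1_(~` G `&` [set x | M * phi x <= `|f l x|]) x) dl].
Proof.
pose stuck G := forall l, ~ massive l (~` G `&` peak l).
(* The induction also carries the [phi]-mass of the union of the removed pieces, since this union
   becomes [G] once the process is stuck. *)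
suff : (exists (l : nat -> L) (A : nat -> set T), [/\ forall i, measurable (A i),
     forall i j, (i < m)%N -> (j < m)%N -> i != j -> A i `&` A j = set0,
     forall i, (i < m)%N -> massive (l i) (A i) &
     integral_le mu (fun x => phi x * \1_(\big[setU/set0]_(i < m) A i) x)
       (m%:R * (u / M))]) \/
  exists G, [/\ measurable G,
    integral_le mu (fun x => phi x * \1_G x) (m%:R * (u / M)) & stuck G].
  case=> [[l [A [mA Adis Amass _]]]|[G [mG phiG stuckG]]].
    by left; exists l, A.
  right; exists G; split=> // l; split.
  - apply: measurable_funM; first exact: measurable_fun_normr.
    apply: measurable_indic; apply: measurableI; first exact: measurableC.
    exact: mpeak.
  - by move=> x; rewrite mulr_ge0.
  - by rewrite ltW// ltNge; apply/negP/stuckG.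
elim: m => [|m [[l [A [mA Adis Amass phiA]]]|[G [mG phiG stuckG]]]].
(* With [L] empty no sequence of indices exists, but then the process is stuck at the empty set. *)
- have [[l0]|noL] := pselect (inhabited L).
    left; exists (fun=> l0), (fun=> set0); split=> //.
    rewrite big_ord0 mul0r; under [X in integral_le _ X]eq_fun do rewrite indic0 mulr0.
    exact: integral_le0.
  right; exists set0; split=> //; last by move=> l; case: noL.
  rewrite mul0r; under [X in integral_le _ X]eq_fun do rewrite indic0 mulr0.
  exact: integral_le0.
- set G := \big[setU/set0]_(i < m) A i in phiA.
  have mG : measurable G by exact: bigsetU_measurable.
  have um : m%:R * (u / M) <= m.+1%:R * (u / M).
    by rewrite ler_wpM2r ?ler_nat// divr_ge0// ltW.
  have [stuckG|] := pselect (stuck G).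
    by right; exists G; split=> //; exact: integral_leW phiA um.
  move=> /existsNP[l1 /contrapT l1mass].
  pose A1 := ~` G `&` peak l1.
  have mA1 : measurable A1 by apply: measurableI => //; exact: measurableC.
  have A1dis i : (i < m)%N -> A i `&` A1 = set0.
    move=> im; apply/seteqP; split=> // x [Aix [nGx _]]; apply: nGx.
    by rewrite /G -bigcup_mkord; exists i.
  left; exists (fun i => if i == m then l1 else l i),
    (fun i => if i == m then A1 else A i); split.
  + by move=> i; case: ifP.
  + move=> i j; rewrite !ltnS [(i <= m)%N]leq_eqVlt [(j <= m)%N]leq_eqVlt.
    case: eqVneq => [->|im] /=; case: eqVneq => [->|jm] //=.
    * by move=> _ jm' _; rewrite setIC A1dis.
    * by move=> im' _ _; rewrite A1dis.
    * exact: Adis.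
  + move=> i; rewrite ltnS leq_eqVlt; case: eqVneq => //= _; exact: Amass.
  + rewrite big_ord_recr/= eqxx (eq_bigr (fun i : 'I_m => A i)) => [|i _]; last first.
      by rewrite ltn_eqF.
    rewrite -/G -natr1 mulrDl mul1r.
    have phiA1 : integral_le mu (fun x => phi x * \1_A1 x) (u / M).
      by apply: (phi_peak (l := l1)) => // x [].
    apply: integral_leS (integral_leD phiA phiA1) _ _ _.
    * apply: measurable_funM => //; apply: measurable_indic.
      exact: measurableU.
    * by move=> x; rewrite mulr_ge0.
    * move=> x; rewrite -mulrDr ler_wpM2l// !indicE in_setU.
      by case: (x \in G); case: (x \in A1); rewrite /= ?addr0 ?add0r ?lerDl.
- right; exists G; split=> //; apply: integral_leW phiG _.
  by rewrite ler_wpM2r ?ler_nat// divr_ge0// ltW.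
Qed.

End Greedy.

(** * The trace estimate *)

Ltac nneg := repeat first [done | exact: sqr_ge0 | exact: exprn_even_ge0 |
  exact: ltW | apply: addr_ge0 | apply: mulr_ge0 | rewrite invr_ge0 |
  apply: exprn_ge0 | (apply: sumr_ge0 => ? _)].

(** A Young-type inequality. If |y| / p <= lam, the first term suffices by |k| <= |f|; otherwise k
    <= M p and the extra factor (|y| / (p lam))^q is at least 1. The degenerate cases p = 0 and lam
    = 0 have left-hand side 0. *)
Lemma scaled_norm_mul_le (R : realFieldType) (q : nat) (y f p k lam M : R) :
  0 <= p -> 0 <= lam -> 0 <= M -> 0 <= k -> `|k| <= `|f| -> k <= M * p ->
  (lam = 0 -> y = 0) ->
  `|y| * p^-1 * k <= lam * `|f| + M / lam ^+ q * (`|y| ^+ q.+1 * p^-1 ^+ q).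
Proof.
move=> p0 lam0 M0 k0 kf kM lamy.
have rhs0 : 0 <= M / lam ^+ q * (`|y| ^+ q.+1 * p^-1 ^+ q).
  by rewrite !mulr_ge0 ?exprn_ge0// ?invr_ge0// exprn_ge0.
have [p_eq0|p_neq0] := eqVneq p 0.
  by rewrite {1}p_eq0 invr0 mulr0 mul0r; apply: addr_ge0 => //; exact: mulr_ge0.
have [lam_eq0|lam_neq0] := eqVneq lam 0.
  by rewrite {1}lamy// normr0 !mul0r; apply: addr_ge0 => //; exact: mulr_ge0.
have p_gt0 : 0 < p by rewrite lt_def p_neq0.
have lam_gt0 : 0 < lam by rewrite lt_def lam_neq0.
have a0 : 0 <= `|y| * p^-1 by rewrite mulr_ge0// invr_ge0.
have [a_le|/ltW lam_le] := leP (`|y| * p^-1) lam.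
  rewrite ler_wpDr// (le_trans (ler_wpM2l a0 (ler_norm k)))//.
  exact: ler_pM.
rewrite ler_wpDl ?mulr_ge0//.
have -> : M / lam ^+ q * (`|y| ^+ q.+1 * p^-1 ^+ q) =
    `|y| * p^-1 * (M * p) * ((`|y| * p^-1) / lam) ^+ q.
  rewrite !exprMn !exprVn exprS; field.
  by rewrite expf_neq0 ?lam_neq0// p_neq0 expf_neq0.
apply: le_trans (ler_wpM2l a0 kM) _; apply: ler_peMr.
  by apply: mulr_ge0 => //; apply: mulr_ge0.
by apply: exprn_ege1; rewrite ler_pdivlMr// mul1r.
Qed.

Section Core.
Variables (R : rcfType) (n : nat) (Om L : finType) (r : Om -> nat -> R).
Hypothesis Om0 : (0 < #|Om|)%N.
Hypothesis r2 : forall b : nat -> R,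
  \sum_om (\sum_(i < n) r om i * b i) ^+ 2 = #|Om|%:R * \sum_(i < n) b i ^+ 2.
Hypothesis r4 : forall b : nat -> R,
  \sum_om (\sum_(i < n) r om i * b i) ^+ 4 <=
  3 * #|Om|%:R * (\sum_(i < n) b i ^+ 2) ^+ 2.

Let N : R := #|Om|%:R.
Let N0 : 0 < N. Proof. by rewrite ltr0n. Qed.

(** The variance of the squared sign sum is nonnegative. *)
Lemma sqr_norm2_le_rademacher4 (b : nat -> R) :
  (\sum_(i < n) b i ^+ 2) ^+ 2 <=
  N^-1 * \sum_om (\sum_(i < n) r om i * b i) ^+ 4.
Proof.
rewrite mulrC ler_pdivlMr//; set s := \sum_(i < n) _.
have : 0 <= \sum_om ((\sum_(i < n) r om i * b i) ^+ 2 - s) ^+ 2.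
  by rewrite sumr_ge0// => om _; exact: sqr_ge0.
rewrite (eq_bigr (fun om => (\sum_(i < n) r om i * b i) ^+ 4 +
    (- (2 * s)) * (\sum_(i < n) r om i * b i) ^+ 2 + s ^+ 2)) => [|om _]; last by ring.
rewrite !big_split/= -mulr_sumr r2 sumr_const -[_ *+ #|_|]mulr_natr -/N.
by set S4 := \sum_om _ => h; rewrite -subr_ge0; apply: le_trans h _; rewrite le_eqVlt; apply/orP; left; apply/eqP; rewrite /s; ring.
Qed.

(* At a point where the square function [sum a_i^2] of [a = x / p] exceeds
   [al^2] the left-hand side is absorbed by the fourth moment. Elsewhere [x_i]
   is split into [sum_l w_il v_l], with [v_l] the truncation of [f_l], and a
   remainder paired with [a] by Cauchy-Schwarz and Khintchine. *)
Lemma core_pointwise (q : nat) (x : nat -> R) (p : R) (f : L -> R)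
    (w : nat -> L -> R) (lam : L -> R) (inG : bool) (al s M : R) :
  0 <= p -> 0 < al -> 0 < s -> 0 < M -> (forall l, 0 <= lam l) ->
  (forall l, lam l = 0 -> forall i, (i < n)%N -> w i l = 0) ->
  \sum_(i < n) x i ^+ 2 * p^-1 <=
  (N * al ^+ 2)^-1 * (\sum_om (\sum_(i < n) r om i * x i) ^+ 4 * p^-1 ^+ 3) +
  2 * al / N * (\sum_om
    (s / 2 * (p * inG%:R) + (2 * s)^-1 * ((\sum_(i < n) r om i * x i) ^+ 2 * p^-1) +
     `|\sum_(i < n) r om i * x i - \sum_l (\sum_(i < n) r om i * w i l) * f l| +
     \sum_l `|\sum_(i < n) r om i * w i l| *
       (`|f l| * (~~ inG && (M * p <= `|f l|))%:R))) +
  \sum_l (lam l * `|f l| + M / lam l ^+ q *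
    (`|\sum_(i < n) w i l * x i| ^+ q.+1 * p^-1 ^+ q)).
Proof.
move=> p0 al0 s0 M0 lam0 lamw.
pose lin om := \sum_(i < n) r om i * x i.
pose wom om l := \sum_(i < n) r om i * w i l.
pose E om := s / 2 * (p * inG%:R) + (2 * s)^-1 * (lin om ^+ 2 * p^-1) +
  `|lin om - \sum_l wom om l * f l| +
  \sum_l `|wom om l| * (`|f l| * (~~ inG && (M * p <= `|f l|))%:R).
change (\sum_(i < n) x i ^+ 2 * p^-1 <=
  (N * al ^+ 2)^-1 * (\sum_om lin om ^+ 4 * p^-1 ^+ 3) +
  2 * al / N * \sum_om E om +
  \sum_l (lam l * `|f l| + M / lam l ^+ q *
    (`|\sum_(i < n) w i l * x i| ^+ q.+1 * p^-1 ^+ q))).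
have pV0 : 0 <= p^-1 by rewrite invr_ge0.
have E0 om : 0 <= E om.
  by rewrite /E; nneg.
have t1 : 0 <= (N * al ^+ 2)^-1 * \sum_om lin om ^+ 4 * p^-1 ^+ 3.
  by nneg.
have t2 : 0 <= 2 * al / N * \sum_om E om.
  by nneg.
have t3 : 0 <= \sum_l (lam l * `|f l| + M / lam l ^+ q *
    (`|\sum_(i < n) w i l * x i| ^+ q.+1 * p^-1 ^+ q)).
  by nneg.
have [p_eq0|p_neq0] := eqVneq p 0.
  rewrite [leLHS]big1 => [|i _]; last by rewrite p_eq0 invr0 mulr0.
  by rewrite !addr_ge0.
have {p_neq0}p_gt0 : 0 < p by rewrite lt_def p_neq0.
pose a i := x i * p^-1.
set om2 := \sum_(i < n) a i ^+ 2.
have lhsE : \sum_(i < n) x i ^+ 2 * p^-1 = om2 * p.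
  by rewrite mulr_suml; apply: eq_bigr => i _; rewrite /a; field; rewrite gt_eqF.
have lina om : \sum_(i < n) r om i * a i = lin om * p^-1.
  by rewrite mulr_suml; apply: eq_bigr => i _; rewrite /a mulrA.
have om20 : 0 <= om2 by rewrite sumr_ge0// => i _; exact: sqr_ge0.
(* Where om2 >= al^2, om2 is at most om2^2 / al^2, and om2^2 is at most the average fourth
   moment. *)
have [om_le|/ltW al_le] := leP om2 (al ^+ 2); last first.
  rewrite -addrA; apply: ler_wpDr; first exact: addr_ge0.
  rewrite lhsE invfM.
  have -> : \sum_om lin om ^+ 4 * p^-1 ^+ 3 =
      (\sum_om (\sum_(i < n) r om i * a i) ^+ 4) * p.
    by rewrite mulr_suml; apply: eq_bigr => om _; rewrite lina; field; rewrite gt_eqF.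
  rewrite mulrA ler_pM2r// mulrAC ler_pdivlMr ?exprn_gt0//.
  apply: le_trans (sqr_norm2_le_rademacher4 a).
  by rewrite expr2 ler_wpM2l.
rewrite -addrA ler_wpDl// lhsE.
(* Vanishing both on [G] and on the peak, v_l satisfies |v_l| <= M p everywhere. *)
pose v l := if inG || (M * p <= `|f l|) then 0 else f l.
pose rem i := x i - \sum_l w i l * v l.
have -> : om2 * p = \sum_(i < n) a i * rem i +
    \sum_l (\sum_(i < n) w i l * x i) * p^-1 * v l.
  rewrite (eq_bigr (fun l => \sum_(i < n) a i * (w i l * v l))); last first.
    move=> l _; rewrite !mulr_suml; apply: eq_bigr => i _; rewrite /a; ring.
  rewrite exchange_big/= -big_split/= mulr_suml; apply: eq_bigr => i _.
  rewrite -mulr_sumr -mulrDr /rem subrK /a; field; by rewrite gt_eqF.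
apply: lerD; last first.
  apply: ler_sum => l _; apply: le_trans (ler_norm _) _.
  rewrite !normrM [`|p^-1|]ger0_norm//; apply: scaled_norm_mul_le => //.
  - exact: ltW.
  - by rewrite normr_id /v; case: ifP => _ //; rewrite normr0.
  - rewrite /v; case: ifP => [_|/negbT].
      by rewrite normr0 mulr_ge0// ltW.
    by rewrite negb_or -ltNge => /andP[_ /ltW].
  - by move=> /lamw w0; rewrite big1// => i _; rewrite w0 ?mul0r.
apply: le_trans (sum_mul_le_norm2 (fun i : 'I_n => rem i) al0 om_le) _.
rewrite -mulrA [2 * _]mulrC -[leRHS]mulrA; apply: ler_wpM2l; first exact: ltW.
rewrite mulrCA ler_pdivlMl//.
apply: le_trans (khintchine_L1 (r2 rem) (r4 rem)) _.
apply: ler_wpM2l => //; apply: ler_sum => om _.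
have -> : \sum_(i < n) r om i * rem i = lin om - \sum_l wom om l * v l.
  rewrite (eq_bigr (fun l => \sum_(i < n) r om i * (w i l * v l))); last first.
    by move=> l _; rewrite mulr_suml; apply: eq_bigr => i _; rewrite mulrA.
  rewrite exchange_big/= -sumrB; apply: eq_bigr => i _.
  by rewrite -mulr_sumr -mulrBr.
have bad0 : 0 <= \sum_l `|wom om l| * (`|f l| * (~~ inG && (M * p <= `|f l|))%:R).
  by nneg.
rewrite /E; have [inGT|/negbTE inGF] := boolP inG.
  rewrite [X in `|_ - X|]big1 => [|l _]; last by rewrite /v inGT mulr0.
  rewrite subr0 -addrA; apply: ler_wpDr; first by nneg.
  (* On [G] every v_l is 0, and the whole of |lin| is split by AM-GM with weight s p. *)
  have -> : s / 2 * (p * true%:R) + (2 * s)^-1 * (lin om ^+ 2 * p^-1) =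
      `|lin om| + (2 * s * p)^-1 * (`|lin om| - s * p) ^+ 2.
    rewrite -[lin om ^+ 2]real_normK ?num_real//=; field.
    by rewrite !gt_eqF.
  by rewrite lerDl; nneg.
rewrite -addrA; apply: ler_wpDl; first by nneg.
(* Off [G] the difference f_l - v_l survives only on the peak, which the last summand of [E] pays
   for. *)
have -> : lin om - \sum_l wom om l * v l = (lin om - \sum_l wom om l * f l) +
    \sum_l wom om l * (f l - v l).
  rewrite -addrA -sumrN -!sumrN -big_split/=; congr (_ + _).
  by apply: eq_bigr => l _; ring.
apply: le_trans (ler_normD _ _) _; rewrite lerD2l.
apply: le_trans (ler_norm_sum _ _ _) _; apply: ler_sum => l _.
rewrite normrM ler_wpM2l// /v inGF/=; case: ifP => _; first by rewrite subr0 mulr1.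
by rewrite subrr normr0 mulr0.
Qed.

End Core.

(** The pointwise estimate integrated. The three summands are the cost of the points with a large
    square function, the L_1 error of the truncation, and the main term from pairing L_Q with its
    dual. *)
Lemma core_bound d (T : measurableType d) (R : realType)
    (mu : {measure set T -> \bar R}) (n q : nat) (Om L : finType)
    (r : Om -> nat -> R) (x : nat -> T -> R) (phi : T -> R) (G : set T)
    (f : L -> T -> R) (w : nat -> L -> R) (K4 kap rho u dl eta wn al s : R) :
  (0 < #|Om|)%N -> (forall om i, r om i ^+ 2 = 1) ->
  (forall b : nat -> R, \sum_om (\sum_(i < n) r om i * b i) ^+ 2 =
    #|Om|%:R * \sum_(i < n) b i ^+ 2) ->
  (forall b : nat -> R, \sum_om (\sum_(i < n) r om i * b i) ^+ 4 <=
    3 * #|Om|%:R * (\sum_(i < n) b i ^+ 2) ^+ 2) ->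
  measurable_fun setT phi -> (forall t, 0 <= phi t) ->
  (forall i, measurable_fun setT (x i)) ->
  (forall c : nat -> R, (\int[mu]_t ((\sum_(i < n) c i * x i t) ^+ 2 * (phi t)^-1)%:E =
    (\sum_(i < n) c i ^+ 2)%:E)%E) ->
  (forall c : nat -> R, integral_le mu
    (fun t => (\sum_(i < n) c i * x i t) ^+ 4 * (phi t)^-1 ^+ 3)
    (K4 * (\sum_(i < n) c i ^+ 2) ^+ 2)) ->
  (forall c : nat -> R, integral_le mu
    (fun t => `|\sum_(i < n) c i * x i t| ^+ q.+1 * (phi t)^-1 ^+ q)
    ((kap * Num.sqrt (\sum_(i < n) c i ^+ 2)) ^+ q.+1)) ->
  measurable G -> integral_le mu (fun t => phi t * \1_G t) rho ->
  (forall l, measurable_fun setT (f l)) ->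
  (forall l, integral_le mu (fun t => `|f l t|) u) ->
  (forall l, integral_le mu (fun t => `|f l t| *
    \1_(~` G `&` [set t | 2 ^+ q.+1 * phi t <= `|f l t|]) t) dl) ->
  (forall om, \sum_l `|\sum_(i < n) r om i * w i l| <= wn) ->
  (forall om, integral_le mu (fun t => `|\sum_(i < n) r om i * x i t -
    \sum_l (\sum_(i < n) r om i * w i l) * f l t|) eta) ->
  0 < kap -> 0 <= u -> 0 <= dl -> 0 < al -> 0 < s ->
  n%:R <= (al ^+ 2)^-1 * (K4 * n%:R ^+ 2) +
    2 * al * (s / 2 * rho + (2 * s)^-1 * n%:R + eta + wn * dl) +
    (u + 1) * (4 * kap * wn).
Proof.
move=> Om0 r1 r2 r4 mphi phi0 mx H2 H4 HQ mG phiG mf fu fdl wwn feta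
  kap0 u0 dl0 al0 s0.
pose nw l := Num.sqrt (\sum_(i < n) w i l ^+ 2).
(* Twice the L_Q bound for [\sum_i w_il x_i]: as M = 2^(q+1), the term M / lam^q * (kap nw)^(q+1)
   then collapses to [lam l]. *)
pose lam l := 2 * kap * nw l.
pose N : R := #|Om|%:R.
have N0 : 0 < N by rewrite ltr0n.
have nw0 l : 0 <= nw l by exact: sqrtr_ge0.
have lam0 l : 0 <= lam l by rewrite /lam; nneg.
have lamw l : lam l = 0 -> forall i, (i < n)%N -> w i l = 0.
  move=> /eqP; rewrite /lam mulf_eq0 gt_eqF ?mulr_gt0//= sqrtr_eq0 => w_le0 i im.
  have : \sum_(i < n) w i l ^+ 2 == 0.
    by rewrite eq_le w_le0 sumr_ge0// => j _; exact: sqr_ge0.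
  rewrite psumr_eq0 => [/allP/(_ (Ordinal im))|j _]; last exact: sqr_ge0.
  by rewrite mem_index_enum sqrf_eq0 => /(_ isT)/eqP.
have M0 : 0 < 2 ^+ q.+1 :> R by rewrite exprn_gt0.
have mphiV := measurable_fun_invr mphi phi0.
have phiV0 t : 0 <= (phi t)^-1 by rewrite invr_ge0.
have mlin (c : nat -> R) : measurable_fun setT (fun t => \sum_(i < n) c i * x i t).
  exact: (measurable_fun_lin _ (fun i : 'I_n => c i) (F := fun i : 'I_n => x i)).
have sum_r om : \sum_(i < n) r om i ^+ 2 = n%:R.
  by rewrite (eq_bigr (fun=> 1)) => [|i _]; rewrite ?r1// sumr_const card_ord.
have bound2 om : integral_le mu
    (fun t => (\sum_(i < n) r om i * x i t) ^+ 2 * (phi t)^-1) n%:R.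
  split; last by rewrite H2 sum_r.
    by apply: measurable_funM => //; exact: measurable_funX.
  by move=> t; nneg.
pose E om t := s / 2 * (phi t * (t \in G)%:R) +
    (2 * s)^-1 * ((\sum_(i < n) r om i * x i t) ^+ 2 * (phi t)^-1) +
    `|\sum_(i < n) r om i * x i t - \sum_l (\sum_(i < n) r om i * w i l) * f l t| +
    \sum_l `|\sum_(i < n) r om i * w i l| *
      (`|f l t| * (~~ (t \in G) && (2 ^+ q.+1 * phi t <= `|f l t|))%:R).
have boundE om : integral_le mu (E om) (s / 2 * rho + (2 * s)^-1 * n%:R + eta + wn * dl).
  apply: (@integral_leW _ _ _ _ _ (s / 2 * rho + (2 * s)^-1 * n%:R + eta +
     \sum_l `|\sum_(i < n) r om i * w i l| * dl)); last first.
    by rewrite lerD2l -mulr_suml ler_wpM2r.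
  apply: integral_leD; first apply: integral_leD; first apply: integral_leD.
  - by apply: integral_leZ; [nneg|under eq_fun do rewrite -indicE].
  - by apply: integral_leZ; [nneg|].
  - exact: feta.
  - apply: integral_le_sum => l; apply: integral_leZ => //.
    have := fdl l; congr (integral_le _ _ _); apply/funext => t.
    rewrite indicE in_setI in_setC; congr (_ * (_ && _)%:R).
    by apply/idP/idP; rewrite inE.
pose F t := (N * al ^+ 2)^-1 * (\sum_om (\sum_(i < n) r om i * x i t) ^+ 4 * (phi t)^-1 ^+ 3) +
  2 * al / N * (\sum_om E om t) +
  \sum_l (lam l * `|f l t| + 2 ^+ q.+1 / lam l ^+ q *
    (`|\sum_(i < n) w i l * x i t| ^+ q.+1 * (phi t)^-1 ^+ q)).
have boundF : integral_le mu F ((N * al ^+ 2)^-1 * (\sum_(om : Om) K4 * n%:R ^+ 2) +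
    2 * al / N * (\sum_(om : Om) (s / 2 * rho + (2 * s)^-1 * n%:R + eta + wn * dl)) +
    \sum_l (lam l * u + 2 ^+ q.+1 / lam l ^+ q * (kap * nw l) ^+ q.+1)).
  apply: integral_leD; first apply: integral_leD.
  - apply: integral_leZ; first by nneg.
    by apply: integral_le_sum => om; rewrite -(sum_r om); exact: H4.
  - apply: integral_leZ; first by nneg.
    by apply: integral_le_sum => om.
  - apply: integral_le_sum => l; apply: integral_leD.
      exact: integral_leZ.
    by apply: integral_leZ; [nneg|exact: (HQ (w ^~ l))].
have lhs : (\int[mu]_t (\sum_(i < n) x i t ^+ 2 * (phi t)^-1)%:E = n%:R%:E)%E.
  under eq_integral do rewrite -sumEFin.
  rewrite ge0_integral_sum//; last 2 first.
  - move=> i; apply/measurable_EFinP; apply: measurable_funM => //.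
    exact: measurable_funX.
  - by move=> i t _; rewrite lee_fin; nneg.
  (* Coefficients concentrated at [i] show that each x_i has norm 1, so the trace is n. *)
  rewrite (eq_bigr (fun=> 1%E)) => [|i _]; last first.
    have := H2 (fun j => (j == i)%:R).
    rewrite (bigD1 i)//= eqxx expr1n big1 ?addr0 => [|j ji]; last first.
      by rewrite -val_eqE/= in ji; rewrite (negPf ji) expr0n.
    move=> <-; apply: eq_integral => t _.
    rewrite (bigD1 i)//= eqxx mul1r big1 ?addr0// => j ji.
    by rewrite -val_eqE/= in ji; rewrite (negPf ji) mul0r.
  by rewrite sumEFin sumr_const card_ord.
have : integral_le mu (fun t => \sum_(i < n) x i t ^+ 2 * (phi t)^-1)
    ((N * al ^+ 2)^-1 * (\sum_(om : Om) K4 * n%:R ^+ 2) +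
    2 * al / N * (\sum_(om : Om) (s / 2 * rho + (2 * s)^-1 * n%:R + eta + wn * dl)) +
    \sum_l (lam l * u + 2 ^+ q.+1 / lam l ^+ q * (kap * nw l) ^+ q.+1)).
  apply: (integral_leS boundF).
  - apply: measurable_sum => i; apply: measurable_funM => //.
    exact: measurable_funX.
  - by move=> t; nneg.
  - move=> t; exact: (core_pointwise Om0 r2 r4 q (fun i => x i t) (f ^~ t)
      (t \in G) (phi0 t) al0 s0 M0 lam0 lamw).
case=> _ _; rewrite lhs lee_fin => h; apply: le_trans h _.
have sumN (c : R) : \sum_(om : Om) c = N * c by rewrite sumr_const mulr_natl.
rewrite !sumN.
apply: lerD.
  rewrite le_eqVlt; apply/orP; left; apply/eqP; congr (_ + _).
    by field; rewrite !gt_eqF.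
  by field; rewrite !gt_eqF.
have lamE l : lam l * u + 2 ^+ q.+1 / lam l ^+ q * (kap * nw l) ^+ q.+1 =
    (u + 1) * (2 * kap) * nw l.
  have [nw_eq0|nw_neq0] := eqVneq (nw l) 0.
    by rewrite /lam nw_eq0 !mulr0 mul0r [0 ^+ q.+1]expr0n/= mulr0 addr0.
  have -> : 2 ^+ q.+1 / lam l ^+ q * (kap * nw l) ^+ q.+1 = lam l.
    have -> : 2 ^+ q.+1 / lam l ^+ q * (kap * nw l) ^+ q.+1 = lam l ^+ q.+1 / lam l ^+ q.
      by rewrite mulrAC -exprMn /lam mulrA.
    rewrite exprS mulfK// expf_neq0// /lam !mulf_neq0// gt_eqF//.
  by rewrite /lam; ring.
rewrite (eq_bigr _ (fun l _ => lamE l)) -mulr_sumr -mulrA ler_wpM2l ?addr_ge0//.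
(* By Khintchine the sum of the [nw l] is at most twice an average over signs of sums bounded by
   [wn]. *)
have -> : 4 * kap * wn = 2 * kap * (2 * wn) by ring.
rewrite ler_wpM2l//; first by nneg.
rewrite -(ler_pM2l N0) mulr_sumr.
apply: (@le_trans _ _ (\sum_l 2 * \sum_om `|\sum_(i < n) r om i * w i l|)).
  by apply: ler_sum => l _; exact: (khintchine_L1 (r2 (w ^~ l)) (r4 (w ^~ l))).
rewrite -mulr_sumr exchange_big/= mulrCA ler_wpM2l//.
by rewrite mulr_natl -sumr_const; exact: ler_sum.
Qed.

(** * Operators between L1 spaces *)

Section OperatorNorm.
Context (R : realType) (V W : normedModType R).
Implicit Types (f : {linear V -> W}) (K : R).

Lemma opnorm_le f K : 0 <= K -> (forall x, `|f x| <= K * `|x|) ->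
  (opnorm f <= K%:E)%E.
Proof.
move=> K0 fK; apply: ge_ereal_sup => _ [x /= x1 <-]; rewrite lee_fin.
by rewrite (le_trans (fK x))// -[leRHS]mulr1 ler_wpM2l.
Qed.

Lemma continuous_of_bound f K : (forall x, `|f x| <= K * `|x|) -> continuous f.
Proof.
move=> fK; apply/linear_bounded_continuous/linear_boundedP.
exists K; split=> [|r /ltW Kr x]; first exact: num_real.
by apply: le_trans (fK x) _; exact: ler_wpM2r.
Qed.

Lemma opnorm_ge0 f : (0 <= opnorm f)%E.
Proof.
apply: ereal_sup_ubound; exists 0 => /=; first by rewrite normr0.
by rewrite linear0 normr0.
Qed.

Lemma le_opnorm f : (opnorm f < +oo)%E ->
  forall x, `|f x| <= fine (opnorm f) * `|x|.
Proof.
move=> ffin x; have [->|x0] := eqVneq x 0; first by rewrite linear0 !normr0 mulr0.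
have nx : 0 < `|x| by rewrite normr_gt0.
rewrite -ler_pdivrMr// -lee_fin fineK ?ge0_fin_numE ?opnorm_ge0//.
apply: ereal_sup_ubound; exists (`|x|^-1 *: x) => /=.
  by rewrite normrZ normfV normr_id mulVf ?gt_eqF.
by rewrite linearZ normrZ normfV normr_id mulrC.
Qed.

Lemma opnorm_fin f : continuous f -> (opnorm f < +oo)%E.
Proof.
move=> /linear_bounded_continuous/linear_boundedP/pinfty_ex_gt0[K K0 fK].
by apply: le_lt_trans (opnorm_le (ltW K0) fK) _; rewrite ltry.
Qed.

End OperatorNorm.

Section L1Space.
Context d (T : measurableType d) (R : realType).
Variable mu : {measure set T -> \bar R}.
Local Notation L1 := (LspaceType1 mu).
Implicit Types g h : L1.

Lemma L1_normE g : (`|g|%:E = \int[mu]_t `|Lspace_fun g t|%:E)%E.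
Proof. by rewrite Lspace_normE Lnorm1. Qed.

Lemma integral_le_L1 g : integral_le mu (fun t => `|Lspace_fun g t|) `|g|.
Proof.
split=> //; first exact/measurable_fun_normr/Lspace_measurable.
by rewrite L1_normE.
Qed.

Lemma L1_norm_le g f b : Lspace_fun g = f %[ae mu] ->
  integral_le mu (fun t => `|f t|) b -> `|g| <= b.
Proof.
move=> gf fb; rewrite -lee_fin L1_normE.
have [] // := @integral_le_ae _ _ _ mu (fun t => `|Lspace_fun g t|) _ _ fb.
- exact/measurable_fun_normr/Lspace_measurable.
- by apply: filterS gf => t /(_ I) ->.
Qed.

Lemma L1_integrable g : mu.-integrable setT (EFin \o Lspace_fun g).
Proof. by apply/Lfun1_integrable; exact: Lspace_Lfun. Qed.

Lemma L1_of_integrable (f : T -> R) : mu.-integrable setT (EFin \o f) ->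
  exists g, Lspace_fun g = f %[ae mu].
Proof.
by move=> /Lfun1_integrable fL; exists (Lspace_of (Lfun_Sub (lexx _) fL)); exact: Lspace_ofE.
Qed.

Lemma L1_lin_ae (I : Type) (s : seq I) (c : I -> R) (F : I -> L1) :
  Lspace_fun (\sum_(i <- s) c i *: F i) =
  (fun t => \sum_(i <- s) c i * Lspace_fun (F i) t) %[ae mu].
Proof.
elim: s => [|i s IH].
  rewrite big_nil; have := Lspace0 mu (lexx 1%E).
  by apply: filterS => t /(_ Logic.I) -> _; rewrite big_nil.
rewrite big_cons.
apply: filterS (filterI IH (filterI (LspaceD (c i *: F i) (\sum_(j <- s) c j *: F j))
  (LspaceZ (c i) (F i)))) => t [/(_ Logic.I) E1 [/(_ Logic.I) E2 /(_ Logic.I) E3]] _.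
by rewrite E2/= E1 E3 big_cons.
Qed.

End L1Space.

(** * Functionals on L_1 and disjoint supports *)

Section Functional.
Context d (T : measurableType d) (R : realType).
Variable mu : {measure set T -> \bar R}.
Local Notation L1 := (LspaceType1 mu).
Variables (s : T -> R).
Hypotheses (ms : measurable_fun setT s) (s1 : forall t, `|s t| <= 1).

(** The functional represented by [s]; |s| <= 1 keeps the integrand integrable, so the real-valued
    integral is the true one. *)
Definition pairing (g : L1) : R :=
  \int[mu]_t (s t * Lspace_fun g t).

Let pairing_integrable (g : L1) : mu.-integrable setT (EFin \o (fun t => s t * Lspace_fun g t)).
Proof.
apply: le_integrable (L1_integrable g) => //.
  apply/measurable_EFinP; apply: measurable_funM => //; exact: Lspace_measurable.
by move=> t _; rewrite lee_fin normrM ler_piMl.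
Qed.

Lemma pairing_linear : linear_for *%R pairing.
Proof.
move=> a g h; rewrite /pairing -RintegralZl// -RintegralD//; last first.
  by have := integrableZl measurableT a (pairing_integrable g); congr (_.-integrable _ _).
rewrite /Rintegral; congr fine; apply: ae_eq_integral => //.
- apply/measurable_EFinP; apply: measurable_funM => //; exact: Lspace_measurable.
- apply/measurable_EFinP; apply: measurable_funD.
    by apply: measurable_funM => //; apply: measurable_funM => //; exact: Lspace_measurable.
  by apply: measurable_funM => //; exact: Lspace_measurable.
- apply: filterS (filterI (LspaceD (a *: g) h) (LspaceZ a g)) => t.
  move=> [/(_ I) E1 /(_ I) E2] _; rewrite /= E1/= E2 /=; congr EFin; rewrite /GRing.scale/=; ring.
Qed.

Lemma pairing_norm_le (A : set T) (g : L1) : measurable A ->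
  (forall t, `|s t| <= \1_A t) ->
  (`|pairing g|%:E <= \int[mu]_t (`|Lspace_fun g t| * \1_A t)%:E)%E.
Proof.
move=> mA sA; rewrite /pairing EFin_normr_Rintegral//.
apply: le_trans (le_abse_integral _ _ _) _ => //.
  apply/measurable_EFinP; apply: measurable_funM => //; exact: Lspace_measurable.
apply: ge0_le_integral => //.
- apply/measurable_EFinP/measurable_fun_normr; apply: measurable_funM => //.
  exact: Lspace_measurable.
- apply/measurable_EFinP; apply: measurable_funM; last exact: measurable_indic.
  exact/measurable_fun_normr/Lspace_measurable.
- by move=> t _; rewrite lee_fin normrM mulrC ler_wpM2l.
Qed.

End Functional.

Section DisjointSums.
Context d (T : measurableType d) (R : realType).
Variable mu : {measure set T -> \bar R}.
Variables (I : finType) (A : I -> set T).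
Hypothesis mA : forall i, measurable (A i).
Hypothesis Adis : forall i j, i != j -> A i `&` A j = set0.

Lemma sum_indic_le1 (t : T) : \sum_i \1_(A i) t <= 1 :> R.
Proof.
have [[i Ait]|noA] := pselect (exists i, A i t).
  rewrite (bigD1 i)//= big1 ?addr0 => [|j ji]; first by rewrite indicE; case: (t \in A i).
  rewrite indicE memNset// => Ajt.
  by have : (A j `&` A i) t by []; rewrite Adis.
rewrite big1 => [//|i _]; rewrite indicE memNset// => Ait.
by apply: noA; exists i.
Qed.

Lemma sum_integral_disjoint_le (f : T -> R) : measurable_fun setT f ->
  (\sum_i \int[mu]_t (`|f t| * \1_(A i) t)%:E <= \int[mu]_t `|f t|%:E)%E.
Proof.
move=> mf.
have mF i : measurable_fun setT (fun t => (`|f t| * \1_(A i) t)%:E).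
  apply/measurable_EFinP; apply: measurable_funM; first exact: measurable_fun_normr.
  exact: measurable_indic.
have F0 i t : setT t -> (0 <= (`|f t| * \1_(A i) t)%:E)%E.
  by move=> _; rewrite lee_fin mulr_ge0.
rewrite -(ge0_integral_sum mu measurableT mF F0); apply: ge0_le_integral => //.
- by move=> t _; apply: sume_ge0 => i _; exact: F0.
- exact: emeasurable_sum.
- exact/measurable_EFinP/measurable_fun_normr.
- move=> t _; rewrite sumEFin lee_fin -mulr_sumr ler_piMr//.
  exact: sum_indic_le1.
Qed.

End DisjointSums.

(** * From disjoint peaks to l_1^k *)

Section DisjointPeaks.
Context d (T : measurableType d) (R : realType) (mu : {measure set T -> \bar R}).
Context d' (T' : measurableType d') (nu : {measure set T' -> \bar R}).
Variable U : {linear LspaceType1 nu -> LspaceType1 mu}.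
Variables (m : nat) (u dl : R) (e : nat -> LspaceType1 nu) (A : nat -> set T).
Hypothesis Uu : forall z, `|U z| <= u * `|z|.
Hypotheses (dl0 : 0 < dl) (dlu : dl <= u).
Hypothesis e1 : forall i, `|e i| <= 1.
Hypothesis mA : forall i, measurable (A i).
Hypothesis Adis : forall i j, (i < m)%N -> (j < m)%N -> i != j ->
  A i `&` A j = set0.
Hypothesis Amass : forall i, (i < m)%N ->
  (dl%:E <= \int[mu]_t (`|Lspace_fun (U (e i)) t| * \1_(A i) t)%:E)%E.

Let f i := Lspace_fun (U (e i)).
(** The sign of [f i] cut to [A i], with value 1 at zeros of [f i], so that |s i| is exactly the
    indicator of [A i]. *)
Let s i t : R := \1_(A i) t * (2 * \1_([set t | 0 <= f i t]) t - 1).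

Let ms i : measurable_fun setT (s i).
Proof.
apply: measurable_funM; first exact: measurable_indic.
apply: measurable_funB => //; apply: measurable_funM => //.
apply: measurable_indic; apply: measurable_set_le => //; exact: Lspace_measurable.
Qed.

Let sE i t : `|s i t| = \1_(A i) t.
Proof.
rewrite /s normrM ger0_norm// [X in _ * X](_ : _ = 1) ?mulr1// indicE.
by case: (t \in _); rewrite ?mulr1 ?mulr0 ?sub0r ?normrN ?normr1// -natr1 addrK normr1.
Qed.

Let s1 i t : `|s i t| <= 1.
Proof. by rewrite sE indicE; case: (t \in _). Qed.

Let sfE i t : s i t * f i t = `|f i t| * \1_(A i) t.
Proof.
rewrite /s -mulrA mulrC; congr (_ * _); rewrite indicE.
have [ft|ft] := leP 0 (f i t).
  by rewrite mem_set//= ger0_norm//; ring.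
by rewrite memNset/= ?ltr0_norm ?mulr0 ?sub0r ?mulN1r//; apply/negP; rewrite -ltNge.
Qed.

Let b i j := pairing (mu := mu) (s j) (U (e i)).

Let pairing_sum k (c : 'I_k -> R) (g : 'I_k -> LspaceType1 mu) j :
  pairing (s j) (\sum_i c i *: g i) = \sum_i c i * pairing (s j) (g i).
Proof.
elim/big_rec2: _ => [|i y1 y2 _ <-]; last exact: pairing_linear.
have := pairing_linear (mu := mu) (ms j) (s1 j) 1 0 0.
by rewrite scaler0 addr0 mul1r => /eqP; rewrite -subr_eq0 opprD addNKr oppr_eq0 => /eqP.
Qed.

(** The signs have disjoint supports, so the functionals together form a contraction from L_1 to
    l_1^k. *)
Let sum_pairing_le k (sg : 'I_k -> 'I_m) (g : LspaceType1 mu) : injective sg ->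
  \sum_j `|pairing (s (sg j)) g| <= `|g|.
Proof.
move=> sg_inj; rewrite -lee_fin -sumEFin L1_normE.
apply: (@le_trans _ _ (\sum_j \int[mu]_t (`|Lspace_fun g t| * \1_(A (sg j)) t)%:E)%E).
  by apply: lee_sum => j _; apply: pairing_norm_le => // t; rewrite sE.
apply: sum_integral_disjoint_le => //; last exact: Lspace_measurable.
by move=> i j ij; apply: Adis => //; apply: contra ij => /eqP/val_inj/sg_inj ->.
Qed.

Let b_diag i : (i < m)%N -> dl <= b i i.
Proof.
move=> im; rewrite /b /pairing /Rintegral.
rewrite (eq_integral (fun t => (`|f i t| * \1_(A i) t)%:E)) => [|t _]; last first.
  by rewrite sfE.
rewrite -lee_fin fineK; first exact: Amass.
rewrite ge0_fin_numE; last by apply: integral_ge0 => t _; rewrite lee_fin mulr_ge0.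
have [_ _ fu] := integral_le_L1 (U (e i)); apply: le_lt_trans (ltry `|U (e i)|).
apply: le_trans fu; apply: ge0_le_integral => //.
- apply/measurable_EFinP; apply: measurable_funM; last exact: measurable_indic.
  exact/measurable_fun_normr/Lspace_measurable.
- exact/measurable_EFinP/measurable_fun_normr/Lspace_measurable.
- by move=> t _; rewrite lee_fin ler_piMr// indicE; case: (t \in _).
Qed.

(** On a sparse set of indices the matrix of pairings is diagonally dominant. The identity of l_1^k
    factors as the map sending the unit vectors to the chosen [e i], then U, then the pairings
    followed by the inverse matrix; the outer maps have norms at most 1 and 2 / dl. *)
Lemma gamma_of_disjoint_peaks : exists k : nat,
  m%:R * (dl / (16 * u)) <= k%:R /\
  (gamma_space U (ell1 R k) <= (2 / dl)%:E)%E.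
Proof.
have u0 : 0 < u by exact: lt_le_trans dlu.
pose a i j := if i == j then 0 else if (i < m)%N && (j < m)%N then `|b i j| else 0.
have a0 i j : 0 <= a i j by rewrite /a; case: ifP => // _; case: ifP.
have arow (i : 'I_m) : \sum_(j < m) a i j <= u.
  apply: (@le_trans _ _ (\sum_(j < m) `|b i j|)).
    by apply: ler_sum => j _; rewrite /a; case: ifP => // _; rewrite !ltn_ord.
  apply: le_trans (sum_pairing_le _ (@inj_id 'I_m)) _.
  by rewrite (le_trans (Uu _))// ler_piMr// ltW.
(* Then 2 u / (r + 1) <= dl / 2, as dominance requires, while r + 1 <= 8 u / dl because dl <= u;
   hence m <= (16 u / dl) |S|. *)
pose r := Num.truncn (4 * u / dl).
have x0 : 0 <= 4 * u / dl by rewrite divr_ge0 ?mulr_ge0// ltW.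
have /andP[r_le r_gt] := truncn_itv x0.
have adiag i : a i i = 0 by rewrite /a eqxx.
have [S [mS rowS]] := exists_sparse_subset r u0 a0 adiag arow.
pose k := #|S|; pose sg (i : 'I_k) : 'I_m := enum_val i.
have sg_inj : injective sg by exact: enum_val_inj.
have r_bound : 2 * u / r.+1%:R <= dl / 2.
  rewrite ler_pdivrMr// mulrAC ler_pdivlMr// -ler_pdivrMl//.
  by apply: le_trans (ltW r_gt); rewrite le_eqVlt; apply/orP; left; apply/eqP; field; rewrite gt_eqF.
pose Gm := \matrix_(i < k, j < k) b (sg i) (sg j).
have Gdiag i : dl <= Gm i i by rewrite mxE b_diag.
have Goff i : \sum_(j | j != i) `|Gm i j| <= dl / 2.
  apply: le_trans r_bound; apply: le_trans (rowS (sg i) (enum_valP i)).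
  rewrite [leRHS]big_enum_val/= [leRHS](bigD1 i)//= adiag add0r.
  apply: ler_sum => j ji; rewrite mxE /a !ltn_ord/=.
  by rewrite ifF//; apply/negbTE; apply: contra ji => /eqP/val_inj/sg_inj ->.
have Gunit : Gm \in unitmx by exact: diag_dominant_unitmx Gdiag Goff.
exists k; split.
  have rr : r.+1%:R <= 8 * u / dl.
    rewrite -natr1; apply: (@le_trans _ _ (4 * u / dl + 4 * u / dl)).
      by rewrite lerD// ler_pdivlMr// mul1r; move: u0 dlu; lra.
    by rewrite le_eqVlt; apply/orP; left; apply/eqP; field; rewrite gt_eqF.
  rewrite mulrA ler_pdivrMr ?mulr_gt0// mulrC.
  apply: (@le_trans _ _ (dl * (2 * (8 * u / dl) * k%:R))).
    rewrite ler_pM2l//; apply: le_trans mS _; rewrite ler_wpM2r//.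
    by rewrite ler_pM2l.
  by rewrite le_eqVlt; apply/orP; left; apply/eqP; field; rewrite gt_eqF.
pose Af (z : ell1 R k) : LspaceType1 nu := \sum_i (z : 'rV[R]_k) 0 i *: e (sg i).
have Af_lin : linear Af.
  move=> c z z'; rewrite /Af scaler_sumr -big_split/=; apply: eq_bigr => i _.
  by rewrite !mxE scalerDl scalerA.
pose Al : {linear ell1 R k -> LspaceType1 nu} :=
  HB.pack Af (GRing.isLinear.Build R _ _ _ Af Af_lin).
pose Bf (g : LspaceType1 mu) : ell1 R k :=
  (\row_j pairing (s (sg j)) g) *m invmx Gm.
have Bf_lin : linear Bf.
  move=> c g h; rewrite /Bf.
  have -> : \row_j pairing (s (sg j)) (c *: g + h) =
      c *: (\row_j pairing (s (sg j)) g) + \row_j pairing (s (sg j)) h.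
    by apply/rowP => j; rewrite !mxE pairing_linear.
  by rewrite mulmxDl scalemxAl.
pose Bl : {linear LspaceType1 mu -> ell1 R k} :=
  HB.pack Bf (GRing.isLinear.Build R _ _ _ Bf Bf_lin).
have Al1 z : `|Al z| <= 1 * `|z|.
  rewrite mul1r ell1_normE; apply: le_trans (ler_norm_sum _ _ _) _.
  by apply: ler_sum => i _; rewrite normrZ ler_piMr.
have Bl1 g : `|Bl g| <= 2 / dl * `|g|.
  rewrite ell1_normE -[2 / dl]invf_div ler_pdivlMl ?divr_gt0//.
  apply: le_trans (diag_dominant_l1 _ Gdiag Goff) _.
  rewrite mulmxKV//; apply: le_trans (sum_pairing_le g sg_inj).
  by apply: ler_sum => j _; rewrite mxE.
have dl2 : 0 <= 2 / dl by rewrite divr_ge0// ltW.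
apply: (@le_trans _ _ (opnorm Al * opnorm Bl)%E).
  apply: ereal_inf_lbound; exists Al, Bl; split=> //.
  - exact: continuous_of_bound Al1.
  - exact: continuous_of_bound Bl1.
  move=> z /=; rewrite /Bf /Af linear_sum.
  have -> : \row_j pairing (s (sg j)) (\sum_i U ((z : 'rV[R]_k) 0 i *: e (sg i))) =
      (z : 'rV[R]_k) *m Gm.
    apply/rowP => j; rewrite !mxE.
    rewrite (eq_bigr (fun i => (z : 'rV[R]_k) 0 i *: U (e (sg i)))) => [|i _]; last first.
      by rewrite linearZ.
    by rewrite pairing_sum; apply: eq_bigr => i _; rewrite mxE.
  by rewrite mulmxK.
rewrite -[(2 / dl)%:E]mul1e; apply: lee_pmul; rewrite ?opnorm_ge0//.
  exact: opnorm_le Al1.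
exact: opnorm_le Bl1.
Qed.

End DisjointPeaks.

(** * Approximation by simple functions *)

Section Cells.
Context d (T : measurableType d) (R : realType) (nu : {measure set T -> \bar R}).
Variables (L : finType) (cell : T -> L).
Let E l := cell @^-1` [set l].
Hypothesis mE : forall l, measurable (E l).
Let wt l : R := fine (nu (E l)).
(** The indicator of a cell with integral normalized to 1; it is 0 when [wt l] is 0, as 0^-1 = 0. *)
Let g l t : R := (wt l)^-1 * \1_(E l) t.

Let wt0 l : 0 <= wt l. Proof. exact: fine_ge0. Qed.

Let g0 l t : 0 <= g l t. Proof. by rewrite /g mulr_ge0// invr_ge0. Qed.

Let mg l : measurable_fun setT (g l).
Proof. by apply: measurable_funM => //; exact: measurable_indic. Qed.

Let sum_g (F : L -> R) t : \sum_l F l * g l t = F (cell t) / wt (cell t).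
Proof.
rewrite (bigD1 (cell t))//= big1 ?addr0 => [|l lt].
  by rewrite /g indicE mem_set//= mulr1.
by rewrite /g indicE memNset ?mulr0//= => /esym/eqP; apply/negP.
Qed.

Let int_g l : (\int[nu]_t (g l t)%:E = (wt l != 0)%:R%:E)%E.
Proof.
under eq_integral do rewrite EFinM.
rewrite ge0_integralZl_EFin//; last 2 first.
- by apply/measurable_EFinP; exact: measurable_indic.
- by rewrite invr_ge0.
rewrite integral_indic// setIT.
have [w0|w0] := eqVneq (wt l) 0; first by rewrite w0 invr0 mul0e.
have Efin : nu (E l) \is a fin_num.
  by rewrite ge0_fin_numE// ltey; apply: contra w0 => /eqP w0; rewrite /wt w0.
by rewrite -[nu (E l)]fineK// -EFinM mulVf.
Qed.

(* [wt l = 0] holds both for null cells and, as [fine +oo = 0], for cells of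
   infinite measure, on which an integrable function constant on cells vanishes. *)
Lemma cell_basis : exists e : L -> LspaceType1 nu,
  [/\ forall l, `|e l| <= 1,
      forall W : L -> R, (forall l, wt l = 0 -> W l = 0) ->
        \sum_l `|W l| <= `|\sum_l W l *: e l| &
      forall v : L -> R, nu.-integrable setT (fun t => (v (cell t))%:E) ->
        Lspace_fun (\sum_l (v l * wt l) *: e l) = v \o cell %[ae nu]].
Proof.
have gi l : nu.-integrable setT (EFin \o g l).
  apply/integrableP; split; first exact/measurable_EFinP.
  under eq_integral do rewrite /= ger0_norm//.
  by rewrite int_g ltry.
have [e eg] := choice (fun l => L1_of_integrable (gi l)).
have lin_ae (W : L -> R) : Lspace_fun (\sum_l W l *: e l) =
    (fun t => W (cell t) / wt (cell t)) %[ae nu].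
  have all_eg : {ae nu, forall t, forall l, Lspace_fun (e l) t = g l t}.
    apply: filterS (filter_forall _ eg) => t h l; exact: h.
  apply: filterS (filterI (L1_lin_ae (index_enum L) W e) all_eg) => t.
  by move=> [/(_ I) -> h] _; rewrite -sum_g; apply: eq_bigr => l _; rewrite h.
exists e; split=> [l|W W0|v vi].
- apply: (L1_norm_le (eg l)); split.
  + exact: measurable_fun_normr.
  + by [].
  + under eq_integral do rewrite ger0_norm//.
    by rewrite int_g lee_fin; case: (_ != _).
- rewrite -lee_fin L1_normE.
  rewrite (ae_eq_integral (fun t => \sum_l (`|W l| * g l t)%:E)%E)//; last 3 first.
  + exact/measurable_EFinP/measurable_fun_normr/Lspace_measurable.
  + by apply: emeasurable_sum => l; apply/measurable_EFinP; exact: measurable_funM.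
  + apply: filterS (lin_ae W) => t /(_ I) -> _.
    by rewrite sumEFin sum_g normrM normfV [`|wt _|]ger0_norm.
  rewrite ge0_integral_sum//; last 2 first.
  + by move=> l; apply/measurable_EFinP; exact: measurable_funM.
  + by move=> l t _; rewrite lee_fin mulr_ge0.
  rewrite -sumEFin; apply: lee_sum => l _.
  under eq_integral do rewrite EFinM.
  rewrite ge0_integralZl_EFin//; last 2 first.
  + by move=> t _; rewrite lee_fin.
  + exact/measurable_EFinP.
  rewrite int_g -EFinM lee_fin; have [/W0 ->|_] := eqVneq (wt l) 0.
    by rewrite normr0 mul0r.
  by rewrite mulr1.
(* Almost every point lies in a cell that is not null. If [wt] is 0 there, the cell has infinite
   measure, and integrability forces [v] to vanish on it. *)
- have null_ae : {ae nu, forall t, nu (E (cell t)) != 0%E}.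
    have null l : {ae nu, forall t, nu (E l) = 0%E -> ~ E l t}.
      have [El0|El0] := pselect (nu (E l) = 0%E); last by apply: aeW => t /El0.
      by exists (E l); split=> // t /= /not_implyP[_ /contrapT].
    apply: filterS (filter_forall _ null) => t h; apply/eqP => Et0.
    exact: h Et0 _.
  apply: filterS (filterI (lin_ae (fun l => v l * wt l)) null_ae) => t.
  move=> [/(_ I) -> Et0] _ /=; have [w0|w0] := eqVneq (wt (cell t)) 0; last by rewrite mulfK.
  rewrite w0 mulr0 mul0r; apply/esym/eqP; apply: contraTT isT => vt0.
  have Ey : nu (E (cell t)) = +oo%E.
    apply/eqP; rewrite -leye_eq leNgt; apply/negP => Efin.
    by move/eqP: Et0; apply; rewrite -[nu _]fineK ?ge0_fin_numE// -/(wt _) w0.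
  have /integrableP[mv] := vi; rewrite ltNge => /negP; case.
  rewrite -(_ : (\int[nu]_(s in E (cell t)) `|v (cell s)|%:E)%E = +oo%E).
    apply: ge0_subset_integral => //.
    exact/measurable_EFinP/measurable_fun_normr/measurable_EFinP.
  rewrite (eq_integral (fun=> `|v (cell t)|%:E)) => [|s]; last first.
    by rewrite inE => ->.
  by rewrite integral_cst// Ey gt0_muley// lte_fin normr_gt0.
Qed.

End Cells.

Import HBSimple.

(** The cells are the joint level sets of the n functions: a label records one value per function,
    out of the finite list [V] of all values. *)
Lemma exists_simple_cells d (T : measurableType d) (R : realType) (n : nat)
    (s : nat -> {sfun T >-> R}) :
  exists (L : finType) (cell : T -> L) (v : nat -> L -> R),
    (forall l, measurable (cell @^-1` [set l])) /\
    forall i t, (i < n)%N -> s i t = v i (cell t).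
Proof.
have [V0 sV0] := choice (fun i => (finite_seqP _).1 (fimfunP (s i))).
pose V := flatten [seq V0 i | i <- iota 0 n].
have sV (i : 'I_n) t : s i t \in V.
  apply/flattenP; exists (V0 i).
    by apply: map_f; rewrite mem_iota add0n ltn_ord.
  have : range (s i) (s i t) by exists t.
  by rewrite sV0.
pose cell t : {ffun 'I_n -> seq_sub V} := [ffun i => SeqSub (sV i t)].
pose v i (l : {ffun 'I_n -> seq_sub V}) : R :=
  if (insub i : option 'I_n) is Some j then ssval (l j) else 0.
exists {ffun 'I_n -> seq_sub V}, cell, v.
split=> [l|i t im]; last by rewrite /v insubT /= ffunE.
have -> : cell @^-1` [set l] =
    \bigcap_(i in [set: 'I_n]) (s i @^-1` [set ssval (l i)]).
  apply/seteqP; split=> t /=; first by move=> <- i _ /=; rewrite ffunE.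
  by move=> st; apply/ffunP => i; rewrite ffunE; apply: val_inj; exact: st.
apply: fin_bigcap_measurable; first exact: finite_finset.
by move=> i _; exact: measurable_sfunP.
Qed.

(** Reduces the range of W to the span of finitely many normalized disjoint indicators. The last
    clause is the l_1 lower estimate on this span, which controls the coefficients by norms. *)
Lemma L1_simple_approx d (T : measurableType d) (R : realType)
    (nu : {measure set T -> \bar R}) (n : nat) (z : nat -> LspaceType1 nu)
    (eta : R) : 0 < eta ->
  exists (L : finType) (e : L -> LspaceType1 nu) (w : nat -> L -> R),
  [/\ forall l, `|e l| <= 1,
      forall i, (i < n)%N -> `|z i - \sum_l w i l *: e l| <= eta &
      forall c : nat -> R, \sum_l `|\sum_(i < n) c i * w i l| <=
        `|\sum_(i < n) c i *: \sum_l w i l *: e l|].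
Proof.
move=> eta0.
have approx i : exists s : {sfun T >-> R}, nu.-integrable setT (EFin \o s) /\
    (\int[nu]_t `|Lspace_fun (z i) t - s t|%:E <= eta%:E)%E.
  have [s_ [si _ s_cvg]] := approximation_sfun_integrable measurableT (L1_integrable (z i)).
  have /s_cvg[k _ hk] := @open_ereal_lt' R 0%E eta%:E eta0.
  exists (s_ k); split; first exact: si.
  by have /ltW := hk k (leqnn k); congr (_ <= _)%E; apply: eq_integral.
have [s hs] := choice approx.
have [L [cell [v [mcell sv]]]] := exists_simple_cells n s.
have [e [e1 eW ev]] := cell_basis nu mcell.
pose wt l := fine (nu (cell @^-1` [set l])).
(* The factor [wt l] undoes the normalization of [e l]. *)
exists L, e, (fun i l => v i l * wt l); split=> // [i im|c].
- have vE : (fun t => v i (cell t)) = s i by apply/funext => t; rewrite sv.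
  have vi : nu.-integrable setT (fun t => (v i (cell t))%:E).
    by have [+ _] := hs i; rewrite -vE.
  have [_ zs] := hs i.
  apply: (@L1_norm_le _ _ _ _ _ (fun t => Lspace_fun (z i) t - s i t)).
    rewrite -scaleN1r; apply: filterS (filterI (LspaceD (z i) (-1 *: \sum_l (v i l * wt l) *: e l))
      (filterI (LspaceZ (-1) (\sum_l (v i l * wt l) *: e l)) (ev _ vi))).
    move=> t [/(_ I) E1 [/(_ I) E2 /(_ I) E3]] _; rewrite E1/= E2/= E3/= -vE.
    by rewrite /GRing.scale/= mulN1r.
  split=> //; apply: measurable_fun_normr; apply: measurable_funB => //.
  exact: Lspace_measurable.
- have -> : \sum_(i < n) c i *: \sum_l (v i l * wt l) *: e l =
      \sum_l (\sum_(i < n) c i * (v i l * wt l)) *: e l.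
    under eq_bigr do rewrite scaler_sumr; rewrite exchange_big/=.
    apply: eq_bigr => l _; rewrite scaler_suml; apply: eq_bigr => i _.
    by rewrite scalerA.
  apply: eW => l wl0; rewrite big1// => i _.
  by rewrite /wt wl0 !mulr0.
Qed.

(** * Changes of density *)

(** The infimum in the change constant also ranges over [s]; the relation between the exponents
    leaves only the conjugate one, even among extended reals. *)
Lemma conjugate_natS (R : realType) (q : nat) (s : \bar R) : (0 < q)%N ->
  ((q.+1%:R%:E)^-1 + s^-1 = 1^-1 :> \bar R)%E ->
  s = (q.+1%:R / q%:R)%:E.
Proof.
move=> q0; have q1 : q.+1%:R != 0 :> R by rewrite pnatr_eq0.
have qn0 : q%:R != 0 :> R by rewrite pnatr_eq0 -lt0n.
rewrite inve1 inver (negPf q1) => h.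
case: (inveP s) h => [//|||r r0]; last 1 first.
- rewrite -EFinD => -[h]; congr EFin.
  have rV : r^-1 = q%:R / q.+1%:R.
    by rewrite -(addKr (q.+1%:R^-1) r^-1) h -natr1; field; rewrite natr1.
  by rewrite -[r]invrK rV invf_div.
- rewrite adde0 => -[/eqP]; rewrite invr_eq1 -natr1 -subr_eq0 addrK => /eqP q_eq0.
  by move: qn0; rewrite q_eq0 eqxx.
- by rewrite addeNy.
Qed.

(* [phi] is [h ^ s] normalized, with [s] conjugate to [q + 1]. *)
Lemma exists_density d (T : measurableType d) (R : realType)
    (mu : {measure set T -> \bar R}) (X : submodClosed (LspaceType1 mu))
    (q : nat) (b : R) : (0 < q)%N ->
  (change_const_subspace q.+1%:R%:E X < b%:E)%E ->
  exists phi : T -> R, [/\ forall t, 0 <= phi t, integral_le mu phi 1,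
    forall x : normed_subspace X,
      {ae mu, forall t, phi t = 0 -> Lspace_fun (val x) t = 0} &
    forall x : normed_subspace X,
      integral_le mu (fun t => `|Lspace_fun (val x) t| ^+ q.+1 * (phi t)^-1 ^+ q)
        ((b * `|x|) ^+ q.+1)].
Proof.
move=> q0 /ereal_inf_lt[_ [s [h [hs hL h0 hx ->]]] hb].
have q1 : q.+1%:R != 0 :> R by rewrite pnatr_eq0.
have qn0 : q%:R != 0 :> R by rewrite pnatr_eq0 -lt0n.
pose s' : R := q.+1%:R / q%:R.
have s'n0 : s' != 0 by rewrite mulf_neq0// invr_eq0.
have sE := conjugate_natS q0 hs; subst s.
have mh : measurable_fun setT h by move: hL; rewrite inE => /andP[/[!inE]].
set wo := weighted_opnorm _ _ _ in hb.
set Lh := ('N[mu]_(_)[_])%E in hb.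
have Lh_fin : Lh \is a fin_num.
  rewrite ge0_fin_numE ?Lnorm_ge0//.
  by move: hL; rewrite inE => /andP[_ /[!inE]].
pose Nh := fine Lh.
have LhE : Lh = Nh%:E by rewrite fineK.
have Nh0 : 0 <= Nh by rewrite fine_ge0// Lnorm_ge0.
have int_h : (\int[mu]_t (h t `^ s')%:E = (Nh `^ s')%:E)%E.
  rewrite -poweR_EFin -LhE /Lh powR_Lnorm//; apply: eq_integral => t _.
  by rewrite /= ger0_norm.
have wo0 : (0 <= wo)%E.
  apply: le_trans (Lnorm_ge0 _ _ _) _; last first.
    by apply: ereal_sup_ubound; exists 0 => //=; rewrite normr0.
have b0 : 0 < b.
  rewrite -lte_fin; apply: le_lt_trans hb; apply: mule_ge0 => //.
  exact: Lnorm_ge0.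
pose phi t := h t `^ s' / Nh `^ s'.
have phi0 t : 0 <= phi t by rewrite divr_ge0 ?powR_ge0.
have mphi : measurable_fun setT phi.
  apply: measurable_funM => //; exact: (measurableT_comp (measurable_powR _)).
have mxphi (x : normed_subspace X) : measurable_fun setT
    (fun t => `|Lspace_fun (val x) t| ^+ q.+1 * (phi t)^-1 ^+ q).
  apply: measurable_funM; apply: measurable_funX.
    exact/measurable_fun_normr/Lspace_measurable.
  exact: measurable_fun_invr.
have xphi0 (x : normed_subspace X) t :
    0 <= `|Lspace_fun (val x) t| ^+ q.+1 * (phi t)^-1 ^+ q.
  by rewrite mulr_ge0 ?exprn_ge0 ?invr_ge0.
(* If [h] is null, all of X vanishes almost everywhere, and [phi] is 0 by the convention for
   division. *)
have [Nh_eq0|Nh_neq0] := eqVneq Nh 0.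
  have h_ae0 : h = cst 0 %[ae mu].
    have : EFin \o h = \0%E %[ae mu].
      apply: (@Lnorm_eq0_eq0 _ _ _ mu _ s'%:E); first exact/measurable_EFinP.
        by rewrite lte_fin divr_gt0// ltr0n.
      by rewrite -/Lh LhE Nh_eq0.
    by apply: filterS => t /(_ I) [ht] _.
  have x_ae0 (x : normed_subspace X) : {ae mu, forall t, Lspace_fun (val x) t = 0}.
    apply: filterS (filterI (hx x) h_ae0) => t [hxt /(_ I) ht0]; exact: hxt.
  exists phi; split=> // [|x|x].
  - split=> //; rewrite (_ : (fun t => _) = cst 0%E) ?integral_cst ?mul0e ?lee_fin//.
    by apply/funext => t; rewrite /phi Nh_eq0 powR0// invr0 mulr0.
  - by apply: filterS (x_ae0 x) => t ->.
  - split=> //; rewrite (ae_eq_integral (cst 0%E))//; last 2 first.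
    + exact/measurable_EFinP.
    + by apply: filterS (x_ae0 x) => t xt _; rewrite xt normr0 expr0n/= mul0r.
    by rewrite integral_cst// mul0e lee_fin exprn_ge0// mulr_ge0// ltW.
have {Nh_neq0}Nh_gt0 : 0 < Nh by rewrite lt_def Nh_neq0.
have wo_fin : wo \is a fin_num.
  rewrite ge0_fin_numE// ltey; apply/eqP => wo_y.
  by move: hb; rewrite wo_y LhE gt0_muley ?lte_fin.
pose K := fine wo.
have NK : Nh * K < b by rewrite -lte_fin EFinM -LhE /K fineK.
have K0 : 0 <= K by exact: fine_ge0.
exists phi; split=> // [|x|x].
- split=> //; under eq_integral do rewrite /phi mulrC EFinM.
  rewrite ge0_integralZl_EFin//; last 3 first.
  + by move=> t _; rewrite lee_fin powR_ge0.
  + by apply/measurable_EFinP; exact: (measurableT_comp (measurable_powR _)).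
  + by rewrite invr_ge0 powR_ge0.
  by rewrite int_h -EFinM mulVf// gt_eqF// powR_gt0.
- apply: filterS (hx x) => t hxt /eqP; rewrite /phi mulf_eq0 invr_eq0.
  rewrite !powR_eq0 (gt_eqF Nh_gt0) orbF s'n0 andbT => /eqP; exact: hxt.
(* As s' q = q + 1, the weight phi^(-q) turns the integrand into a multiple of |x / h|^(q+1). *)
- have phiq t : (phi t)^-1 ^+ q = Nh ^+ q.+1 * (h t)^-1 ^+ q.+1.
    have pw a : 0 <= a -> (a `^ s') ^+ q = a ^+ q.+1.
      by move=> a0; rewrite -powR_mulrn ?powR_ge0// -powRrM divfK// powR_mulrn.
    by rewrite /phi invf_div exprMn !exprVn !pw.
  have xE t : `|Lspace_fun (val x) t| ^+ q.+1 * (phi t)^-1 ^+ q =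
      Nh ^+ q.+1 * `|(h t)^-1 * Lspace_fun (val x) t| ^+ q.+1.
    by rewrite phiq normrM [`|_^-1|]ger0_norm ?invr_ge0// exprMn; ring.
  have [->|x0] := eqVneq x 0.
    split=> //; rewrite (ae_eq_integral (cst 0%E))//; last 2 first.
    + exact/measurable_EFinP.
    + apply: filterS (Lspace0 mu (lexx 1%E)) => t /(_ I) xt _.
      by rewrite xt normr0 expr0n/= mul0r.
    by rewrite integral_cst// mul0e lee_fin exprn_ge0// mulr_ge0// ltW.
  have nx : 0 < `|x| by rewrite normr_gt0.
  pose z := `|x|^-1 *: x.
  have z1 : `|z| <= 1 by rewrite normrZ normfV normr_id mulVf// gt_eqF.
  have bound_z : integral_le mu
      (fun t => `|(h t)^-1 * Lspace_fun (val z) t| ^+ q.+1) (K ^+ q.+1).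
    split.
    + apply/measurable_funX/measurable_fun_normr/measurable_funM.
        exact: measurable_fun_invr.
      exact: Lspace_measurable.
    + by move=> t; rewrite exprn_ge0.
    set Nz := ('N[mu]_(q.+1%:R%:E)[EFin \o (fun t => (h t)^-1 * Lspace_fun (val z) t)%R])%E.
    have NzK : (Nz <= K%:E)%E.
      by rewrite /K fineK//; apply: ereal_sup_ubound; exists z.
    have Nz_ge0 : (0 <= Nz)%E by exact: Lnorm_ge0.
    have Nz_fin : Nz \is a fin_num by rewrite ge0_fin_numE// (le_lt_trans NzK)// ltry.
    rewrite (_ : (\int[mu]_t _)%E = (Nz `^ q.+1%:R)%E); last first.
      rewrite /Nz powR_Lnorm//; apply: eq_integral => t _.
      by rewrite /= powR_mulrn.
    rewrite -[Nz]fineK// poweR_EFin powR_mulrn ?fine_ge0// lee_fin lerXn2r ?nnegrE ?fine_ge0//.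
    by rewrite -lee_fin fineK.
  have Nx0 : 0 <= (Nh * `|x|) ^+ q.+1 by rewrite exprn_ge0// mulr_ge0.
  apply: (@integral_leW _ _ _ _ _ ((Nh * `|x|) ^+ q.+1 * K ^+ q.+1)); last first.
    have NKx : Nh * `|x| * K <= b * `|x|.
      by rewrite mulrAC; apply: ler_wpM2r => //; exact: ltW.
    rewrite -exprMn lerXn2r// nnegrE; first by rewrite !mulr_ge0.
    by rewrite mulr_ge0// ltW.
  apply: (integral_le_ae (integral_leZ Nx0 bound_z)) => //.
  apply: filterS (LspaceZ `|x|^-1 (val x)) => t /(_ I) zt.
  rewrite xE [Lspace_fun (val z) t]zt /= /GRing.scale/=.
  rewrite [leRHS](_ : _ = Nh ^+ q.+1 * (`|x| * `|(h t)^-1 * (`|x|^-1 * Lspace_fun (val x) t)|) ^+ q.+1); last first.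
    by rewrite !exprMn; ring.
  rewrite (_ : `|x| * `|_| = `|(h t)^-1 * Lspace_fun (val x) t|)//.
  by rewrite mulrCA normrM normfV normr_id mulVKf// gt_eqF.
Qed.

(** * The inner product defined by a density *)

Section Density.
Context d (T : measurableType d) (R : realType) (mu : {measure set T -> \bar R}).
Variables (X : submodClosed (LspaceType1 mu)) (phi : T -> R).
Hypotheses (phi0 : forall t, 0 <= phi t) (phi1 : integral_le mu phi 1).
Hypothesis vanish : forall x : normed_subspace X,
  {ae mu, forall t, phi t = 0 -> Lspace_fun (val x) t = 0}.

Let xf (x : normed_subspace X) := Lspace_fun (val x).

Let mphi : measurable_fun setT phi. Proof. by case: phi1. Qed.

Let mxf x : measurable_fun setT (xf x). Proof. exact: Lspace_measurable. Qed.

Let mphiV := measurable_fun_invr mphi phi0.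

(* AM-GM: [2 |f| <= |x| phi + f^2 / (|x| phi)]. *)
Lemma sqr_norm_le_of_density (x : normed_subspace X) (Q : R) :
  integral_le mu (fun t => xf x t ^+ 2 * (phi t)^-1) Q -> `|x| ^+ 2 <= Q.
Proof.
move=> hQ; have [->|x0] := eqVneq x 0.
  rewrite normr0 expr0n/=; have [_ h0] := hQ; rewrite -lee_fin; apply: le_trans.
  by apply: integral_ge0 => t _; rewrite lee_fin h0.
have nx : 0 < `|x| by rewrite normr_gt0.
have : `|x| <= `|x| / 2 * 1 + (2 * `|x|)^-1 * Q.
  apply: (@L1_norm_le _ _ _ mu (val x) (xf x)); first by apply: aeW.
  apply: (integral_le_ae (integral_leD (integral_leZ _ phi1) (integral_leZ _ hQ))).
  - by nneg.
  - by nneg.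
  - exact: measurable_fun_normr.
  - by [].
  apply: filterS (vanish x) => t xt.
  have [p0|p0] := eqVneq (phi t) 0.
    by rewrite /xf xt// normr0 p0 mulr0 add0r expr0n/= mul0r mulr0.
  have p_gt0 : 0 < phi t by rewrite lt_def p0 phi0.
  rewrite -[xf x t ^+ 2]real_normK ?num_real// -subr_ge0.
  rewrite (_ : _ - _ = (2 * `|x| * phi t)^-1 * (`|xf x t| - `|x| * phi t) ^+ 2).
    by apply: mulr_ge0; rewrite ?sqr_ge0// invr_ge0 !mulr_ge0// ltW.
  by field; rewrite p0 gt_eqF.
rewrite mulr1 -lerBlDl (_ : `|x| - _ = `|x| / 2); last by field.
rewrite ler_pdivlMl ?mulr_gt0//.
by have -> : 2 * `|x| * (`|x| / 2) = `|x| ^+ 2 by field.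
Qed.

Variables (b : R).
Hypothesis fourth : forall x : normed_subspace X,
  integral_le mu (fun t => `|xf x t| ^+ 4 * (phi t)^-1 ^+ 3) ((b * `|x|) ^+ 4).

(** From r^2 <= 1 + r^4 with r = |x| / phi. The bound serves only to make the inner product
    finite. *)
Let square_le x : integral_le mu (fun t => xf x t ^+ 2 * (phi t)^-1)
  (1 + (b * `|x|) ^+ 4).
Proof.
apply: (integral_leS (integral_leD phi1 (fourth x))).
- by apply: measurable_funM => //; exact: measurable_funX.
- by move=> t; nneg; rewrite phi0.
move=> t; have [p0|p0] := eqVneq (phi t) 0.
  by rewrite p0 invr0 mulr0 expr0n/= mulr0 addr0.
have p_gt0 : 0 < phi t by rewrite lt_def p0 phi0.
rewrite -[xf x t ^+ 2]real_normK ?num_real// -subr_ge0.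
set a := `|xf x t|; rewrite (_ : _ - _ = (phi t)^-1 ^+ 3 *
  ((phi t ^+ 2 - a ^+ 2 / 2) ^+ 2 + 3 / 4 * a ^+ 4)); last by field.
by nneg; rewrite phi0.
Qed.

Let B x y : R := \int[mu]_t (xf x t * xf y t * (phi t)^-1).

Let B_integrable x y :
  mu.-integrable setT (EFin \o (fun t => xf x t * xf y t * (phi t)^-1)).
Proof.
have mB : measurable_fun setT (fun t => xf x t * xf y t * (phi t)^-1).
  by apply: measurable_funM => //; exact: measurable_funM.
apply/integrableP; split; first exact/measurable_EFinP.
have [] // := @integral_leS _ _ _ mu (fun t => `|xf x t * xf y t * (phi t)^-1|) _ _
  (integral_leD (square_le x) (square_le y)).
- exact: measurable_fun_normr.
- move=> t; rewrite normrM [`|(phi t)^-1|]ger0_norm ?invr_ge0// -mulrDl ler_wpM2r ?invr_ge0//.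
  rewrite normrM -[xf x t ^+ 2]real_normK ?num_real// -[xf y t ^+ 2]real_normK ?num_real//.
  rewrite -subr_ge0 (_ : _ - _ = (`|xf x t| - `|xf y t| / 2) ^+ 2 + 3 / 4 * `|xf y t| ^+ 2); last by field.
  by nneg.
- by move=> _ _ h; apply: le_lt_trans h _; exact: ltry.
Qed.

Let BE x : (\int[mu]_t (xf x t ^+ 2 * (phi t)^-1)%:E = (B x x)%:E)%E.
Proof.
rewrite /B /Rintegral fineK; first by apply: eq_integral => t _; rewrite expr2.
exact: integrable_fin_num (B_integrable x x).
Qed.

Let B_lin x a y z : B x (a *: y + z) = a * B x y + B x z.
Proof.
rewrite /B -RintegralZl// -RintegralD//; last first.
  by have := integrableZl measurableT a (B_integrable x y); congr (_.-integrable _ _).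
rewrite /Rintegral; congr fine; apply: ae_eq_integral => //.
- apply/measurable_EFinP; apply: measurable_funM => //; exact: measurable_funM.
- apply/measurable_EFinP; apply: measurable_funD.
    by apply: measurable_funM => //; apply: measurable_funM => //; exact: measurable_funM.
  by apply: measurable_funM => //; exact: measurable_funM.
- apply: filterS (filterI (LspaceD (a *: val y) (val z)) (LspaceZ a (val y))) => t.
  move=> [/(_ I) E1 /(_ I) E2] _; rewrite /= /xf linearP E1/= E2/=.
  by congr EFin; rewrite /GRing.scale/=; ring.
Qed.

Let B_sym x y : B x y = B y x.
Proof. by rewrite /B; apply: eq_Rintegral => t _; rewrite [xf x t * _]mulrC. Qed.

Let sqr_norm_le_B x : `|x| ^+ 2 <= B x x.
Proof.
apply: sqr_norm_le_of_density; have [m0 p0 _] := square_le x; split=> //.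
by rewrite BE.
Qed.

(** The inner product [B] dominates the squared L_1 norm, hence is positive definite on X and has an
    orthonormal basis. The basis is indexed by all of nat, with value 0 beyond n. *)
Lemma orthonormal_frame (n : nat) (dimX : Vector.axiom n (normed_subspace X)) :
  exists x : nat -> normed_subspace X, forall c : nat -> R,
  [/\ (\int[mu]_t ((\sum_(i < n) c i * xf (x i) t) ^+ 2 * (phi t)^-1)%:E =
       (\sum_(i < n) c i ^+ 2)%:E)%E,
      `|\sum_(i < n) c i *: x i| <= Num.sqrt (\sum_(i < n) c i ^+ 2) &
      xf (\sum_(i < n) c i *: x i) =
        (fun t => \sum_(i < n) c i * xf (x i) t) %[ae mu]].
Proof.
have B_pos x : x != 0 -> 0 < B x x.
  by move=> x0; apply: lt_le_trans (sqr_norm_le_B x); rewrite exprn_gt0// normr_gt0.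
have [xs xs_on] := exists_orthonormal dimX B_lin B_sym B_pos.
pose x i := if (insub i : option 'I_n) is Some j then xs j else 0.
have xE (i : 'I_n) : x i = xs i by rewrite /x valK.
have B_sum y c : B y (\sum_(i < n) c i *: x i) = \sum_(i < n) c i * B y (x i).
  elim/big_rec2: _ => [|i y1 y2 _ <-]; last exact: B_lin.
  have := B_lin y 1 0 0; rewrite scaler0 addr0 mul1r => /eqP.
  by rewrite -subr_eq0 opprD addNKr oppr_eq0 => /eqP.
exists x => c; set y := \sum_(i < n) c i *: x i.
have Byy : B y y = \sum_(i < n) c i ^+ 2.
  rewrite [LHS]B_sum; apply: eq_bigr => i _; rewrite B_sym B_sum (bigD1 i)//=.
  rewrite big1 ?addr0 => [|j ji]; first by rewrite !xE xs_on eqxx mulr1.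
  by rewrite !xE xs_on eq_sym (negPf ji) mulr0.
have y_ae : xf y = (fun t => \sum_(i < n) c i * xf (x i) t) %[ae mu].
  have := L1_lin_ae (mu := mu) (index_enum 'I_n) (fun i => c i) (fun i => val (x i)).
  by rewrite /xf /y linear_sum/= (eq_bigr (fun i : 'I_n => c i *: val (x i))).
split=> //.
- rewrite -Byy -BE; apply: ae_eq_integral => //.
  + apply/measurable_EFinP; apply: measurable_funM => //; apply: measurable_funX.
    exact: measurable_fun_lin.
  + by apply/measurable_EFinP; apply: measurable_funM => //; exact: measurable_funX.
  + by apply: filterS y_ae => t /(_ I) ->.
- have Byy0 : 0 <= \sum_(i < n) c i ^+ 2 by rewrite sumr_ge0// => i _; exact: sqr_ge0.
  by rewrite -[leLHS]ger0_norm// -sqrtr_sqr ler_sqrt// -Byy.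
Qed.

End Density.

(** Since 1 / psi <= 2 / phi where phi > 0, the integral grows by at most 2^q. Where phi = 0 the
    given bound carries no information, so x has to vanish there. *)
Lemma density_half d (T : measurableType d) (R : realType)
    (mu : {measure set T -> \bar R}) (x phi psi : T -> R) (q : nat) (a : R) :
  0 <= a -> measurable_fun setT x -> measurable_fun setT psi ->
  (forall t, 0 <= phi t) -> (forall t, phi t <= 2 * psi t) ->
  {ae mu, forall t, phi t = 0 -> x t = 0} ->
  integral_le mu (fun t => `|x t| ^+ q.+1 * (phi t)^-1 ^+ q) (a ^+ q.+1) ->
  integral_le mu (fun t => `|x t| ^+ q.+1 * (psi t)^-1 ^+ q) ((2 * a) ^+ q.+1).
Proof.
move=> a0 mx mpsi phi0 phi_psi x_phi h.
have psi0 t : 0 <= psi t.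
  by rewrite -(pmulr_rge0 _ (x := 2))// (le_trans (phi0 t)).
have q2 : 0 <= 2 ^+ q :> R by rewrite exprn_ge0.
apply: (@integral_leW _ _ _ _ _ (2 ^+ q * a ^+ q.+1)); last first.
  by rewrite exprMn ler_wpM2r ?exprn_ge0// exprS ler_peMl// ler1n.
apply: (integral_le_ae (integral_leZ q2 h)).
- apply: measurable_funM; first exact/measurable_funX/measurable_fun_normr.
  exact/measurable_funX/measurable_fun_invr.
- by move=> t; rewrite mulr_ge0 ?exprn_ge0 ?invr_ge0.
apply: filterS x_phi => t xt; have [p0|p0] := eqVneq (phi t) 0.
  by rewrite xt// normr0 !expr0n/= !mul0r mulr0.
have p_gt0 : 0 < phi t by rewrite lt_def p0 phi0.
have psi_gt0 : 0 < psi t.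
  by rewrite -(pmulr_rgt0 _ (x := 2))// (lt_le_trans p_gt0).
rewrite mulrCA ler_wpM2l ?exprn_ge0// -exprMn lerXn2r ?nnegrE ?mulr_ge0 ?invr_ge0//.
by rewrite -[2]invrK -invfM lef_pV2 ?posrE ?mulr_gt0 ?invr_gt0// ler_pdivrMl.
Qed.

(** Lets the factor 5^(2D) absorb all losses that are polynomial in C and the norm of U. It follows
    from (m + 1)^3 <= 8 * 5^m at the integer part m of 2D. *)
Lemma cube_le_powR5 (R : realType) (D : R) : 0 <= D -> D ^+ 3 <= 5 `^ (2 * D).
Proof.
move=> D0; have nat5 m : (m.+1 ^ 3 <= 8 * 5 ^ m)%N.
  elim: m => // -[_ //|m IH]; rewrite [in X in (_ <= X)%N]expnS.
  rewrite mulnCA; apply: (@leq_trans (5 * m.+2 ^ 3)); last by rewrite leq_mul2l IH orbT.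
  by rewrite !expnS !expn0; lia.
have D2 : 0 <= 2 * D by rewrite mulr_ge0.
have /andP[m_le m_gt] := truncn_itv D2; set m := Num.truncn (2 * D) in m_le m_gt.
apply: (@le_trans _ _ (5 `^ m%:R)); last by rewrite ler_powR// ler1n.
rewrite powR_mulrn// -(ler_pM2l (x := 8))//.
have -> : 8 * D ^+ 3 = (2 * D) ^+ 3 by ring.
apply: (@le_trans _ _ (m.+1%:R ^+ 3)).
  by rewrite lerXn2r ?nnegrE// ltW.
by rewrite -natrX -natrX -natrM ler_nat.
Qed.

(** Here a^2 = n and S^2 = q + 1, and the trace estimate is used with al = p a / 32, s = p a, rho =
    p^-2, eta = a / p, wn = 2 a, dl = 1 / (2 p). Its three terms are n / 4, 3 n / 16 and at most n /
    4, with sum below n. *)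
Lemma core_numeric (R : realFieldType) (a p C u S : R) :
  0 < a -> 0 < C -> 1 <= u -> p = 2 ^+ 12 * C ^+ 2 -> 0 <= S ->
  S * (2 ^+ 8 * C * u) <= a ->
  a ^+ 2 <= ((p / 2 ^+ 5 * a) ^+ 2)^-1 * ((8 * C) ^+ 4 * (a ^+ 2) ^+ 2) +
    2 * (p / 2 ^+ 5 * a) * (p * a / 2 * (p ^+ 2)^-1 + (2 * (p * a))^-1 * a ^+ 2 +
      a / p + 2 * a * (2 * p)^-1) +
    (u + 1) * (4 * (4 * C * S) * (2 * a)) -> False.
Proof.
move=> a0 C0 u1 pE S0 Sa.
have p0 : p != 0 by rewrite pE mulf_neq0// ?expf_neq0// ?pnatr_eq0// gt_eqF.
have -> : ((p / 2 ^+ 5 * a) ^+ 2)^-1 * ((8 * C) ^+ 4 * (a ^+ 2) ^+ 2) = a ^+ 2 / 4.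
  by rewrite pE; field; rewrite !gt_eqF.
have -> : 2 * (p / 2 ^+ 5 * a) * (p * a / 2 * (p ^+ 2)^-1 + (2 * (p * a))^-1 * a ^+ 2 +
      a / p + 2 * a * (2 * p)^-1) = 3 / 16 * a ^+ 2.
  by field; rewrite p0 gt_eqF.
have third : (u + 1) * (4 * (4 * C * S) * (2 * a)) <= a ^+ 2 / 4.
  apply: (@le_trans _ _ (2 * u * (4 * (4 * C * S) * (2 * a)))).
    apply: ler_wpM2r; first by nneg.
    by move: u1; lra.
  have -> : 2 * u * (4 * (4 * C * S) * (2 * a)) = (S * (2 ^+ 8 * C * u)) * a / 4 by field.
  by rewrite ler_wpM2r// expr2 ler_wpM2r// ltW.
have : 0 < a ^+ 2 by rewrite exprn_gt0.
by move: third; lra.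
Qed.

(** The mean of the densities for the exponents 4 and q + 1; each is at most twice the mean, which
    doubles its constant. *)
Lemma common_density d (T : measurableType d) (R : realType)
    (mu : {measure set T -> \bar R}) (X : submodClosed (LspaceType1 mu))
    (q : nat) (C : R) : (0 < q)%N -> 0 < C ->
  (forall r : R, 2 <= r ->
    (change_const_subspace r%:E X <= (C * Num.sqrt r)%:E)%E) ->
  exists phi : T -> R, [/\ forall t, 0 <= phi t, integral_le mu phi 1,
    forall x : normed_subspace X,
      {ae mu, forall t, phi t = 0 -> Lspace_fun (val x) t = 0},
    forall x : normed_subspace X,
      integral_le mu (fun t => `|Lspace_fun (val x) t| ^+ 4 * (phi t)^-1 ^+ 3)
        ((8 * C * `|x|) ^+ 4) &
    forall x : normed_subspace X,
      integral_le mu (fun t => `|Lspace_fun (val x) t| ^+ q.+1 * (phi t)^-1 ^+ q)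
        ((4 * C * Num.sqrt q.+1%:R * `|x|) ^+ q.+1)].
Proof.
move=> q0 C0 hC.
(* Doubling C makes the inequality strict, so that the infimum supplies an actual change of
   measure. *)
have dens k : (0 < k)%N ->
    (change_const_subspace k.+1%:R%:E X < (2 * C * Num.sqrt k.+1%:R)%:E)%E.
  move=> k0; apply: le_lt_trans (hC _ _) _; first by rewrite ler_nat.
  have : 0 < C * Num.sqrt k.+1%:R by rewrite mulr_gt0// sqrtr_gt0.
  by rewrite lte_fin; lra.
have [phi [phi0 phi1 phix phih]] := exists_density (ltn0Sn 2) (dens _ (ltn0Sn 2)).
have [psi [psi0 psi1 psix psih]] := exists_density q0 (dens _ q0).
have h2 : 0 <= 2^-1 :> R by rewrite invr_ge0.
pose om t := 2^-1 * phi t + 2^-1 * psi t.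
have om1 : integral_le mu om 1.
  apply: (@integral_leW _ _ _ _ _ (2^-1 * 1 + 2^-1 * 1)); last by lra.
  by apply: integral_leD; exact: integral_leZ.
have [mom om0 _] := om1.
have phi_om t : phi t <= 2 * om t by have := psi0 t; rewrite /om; lra.
have psi_om t : psi t <= 2 * om t by have := phi0 t; rewrite /om; lra.
exists om; split=> // x.
- apply: filterS (phix x) => t xt om_eq0; apply: xt; apply/eqP.
  by rewrite eq_le phi0 andbT (le_trans (phi_om t))// om_eq0 mulr0.
- have -> : 8 * C * `|x| = 2 * (2 * C * Num.sqrt 4 * `|x|).
    by rewrite (_ : 4 = 2 ^+ 2) ?sqrtr_sqr ?ger0_norm//; ring.
  apply: (density_half _ _ mom phi0 phi_om (phix x) (phih x)).
    by rewrite !mulr_ge0 ?sqrtr_ge0// ltW.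
  exact: Lspace_measurable.
- have -> : 4 * C * Num.sqrt q.+1%:R * `|x| = 2 * (2 * C * Num.sqrt q.+1%:R * `|x|) by ring.
  apply: (density_half _ _ mom psi0 psi_om (psix x) (psih x)).
    by rewrite !mulr_ge0 ?sqrtr_ge0// ltW.
  exact: Lspace_measurable.
Qed.

(** For a density of mass at most 1 the weighted L_2 norm dominates the L_1 norm, so no constant
    below 1 is possible. This bounds C from below. *)
Lemma change_const_ge1 d (T : measurableType d) (R : realType)
    (mu : {measure set T -> \bar R}) (X : submodClosed (LspaceType1 mu))
    (x : normed_subspace X) (c : R) : x != 0 ->
  (change_const_subspace 2%:E X <= c%:E)%E -> 1 <= c.
Proof.
move=> x0 hc; rewrite leNgt; apply/negP => c1.
(* A number strictly between c and 1 that is also positive. *)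
pose b := (Num.max c 0 + 1) / 2.
have max1 : Num.max c 0 < 1 by rewrite gt_max c1 ltr01.
have cm : c <= Num.max c 0 by rewrite le_max lexx.
have m0 : 0 <= Num.max c 0 by rewrite le_max lexx orbT.
have cb : c < b by rewrite /b; move: (Num.max c 0) cm m0 max1 => z; clear; lra.
have b0 : 0 < b by rewrite /b; move: (Num.max c 0) m0 => z; clear; lra.
have b1 : b < 1 by rewrite /b; move: (Num.max c 0) max1 => z; clear; lra.
have [phi [phi0 phi1 phix phih]] : exists phi : T -> R, [/\ forall t, 0 <= phi t, integral_le mu phi 1,
    forall x : normed_subspace X,
      {ae mu, forall t, phi t = 0 -> Lspace_fun (val x) t = 0} &
    forall x : normed_subspace X,
      integral_le mu (fun t => `|Lspace_fun (val x) t| ^+ 2 * (phi t)^-1 ^+ 1)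
        ((b * `|x|) ^+ 2)].
  by apply: exists_density => //; apply: le_lt_trans hc _; rewrite lte_fin.
have : `|x| ^+ 2 <= (b * `|x|) ^+ 2.
  apply: (sqr_norm_le_of_density phi0 phi1 phix).
  have := phih x; congr (integral_le _ _ _); apply/funext => t.
  by rewrite expr1 real_normK ?num_real.
rewrite exprMn leNgt gtr_pMl ?exprn_gt0 ?normr_gt0//.
by rewrite expr_lt1 ?(ltW b0)// b1.
Qed.

(** * The factorization *)

Section Factorization.
Context (R : realType) d (T : measurableType d) (mu : {measure set T -> \bar R}).
Context d' (T' : measurableType d') (nu : {measure set T' -> \bar R}).
Variables (n : nat) (X : submodClosed (LspaceType1 mu)).
Hypotheses (n0 : (0 < n)%N) (dimX : Vector.axiom n (normed_subspace X)).
Variable C : R.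
Hypotheses (C0 : 0 < C) (hC : forall r : R, 2 <= r ->
  (change_const_subspace r%:E X <= (C * Num.sqrt r)%:E)%E).
Variables (W : {linear normed_subspace X -> LspaceType1 nu})
  (U : {linear LspaceType1 nu -> LspaceType1 mu}) (u : R).
Hypotheses (u1 : 1 <= u) (Uu : forall z, `|U z| <= u * `|z|).
Hypothesis W1 : forall x, `|W x| <= `|x|.
Hypothesis jUW : (\val : normed_subspace X -> LspaceType1 mu) =1 U \o W.

Variable p : R.
Hypothesis pE : p = 2 ^+ 12 * C ^+ 2.

(** If the greedy removal got stuck before m pieces, the trace estimate would contradict the
    hypothesis that n is large compared with q + 1. *)
Lemma exists_disjoint_peaks (q m : nat) : (0 < q)%N -> 1 <= p ->
  q.+1%:R * (2 ^+ 16 * C ^+ 2 * u ^+ 2) <= n%:R ->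
  m%:R * (u / 2 ^+ q.+1) <= (p ^+ 2)^-1 ->
  exists (e : nat -> LspaceType1 nu) (A : nat -> set T),
  [/\ forall i, `|e i| <= 1, forall i, measurable (A i),
      forall i j, (i < m)%N -> (j < m)%N -> i != j -> A i `&` A j = set0 &
      forall i, (i < m)%N -> (((2 * p)^-1)%:E <=
        \int[mu]_t (`|Lspace_fun (U (e i)) t| * \1_(A i) t)%:E)%E].
Proof.
move=> q0 p1 qn mp.
have p_gt0 : 0 < p by exact: lt_le_trans p1.
have u_gt0 : 0 < u by exact: lt_le_trans u1.
pose a : R := Num.sqrt n%:R.
have n_gt0 : 0 < n%:R :> R by rewrite ltr0n.
have a0 : 0 < a by rewrite sqrtr_gt0.
have a2 : a ^+ 2 = n%:R by rewrite sqr_sqrtr.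
have a1 : 1 <= a by rewrite -(sqrtr1 R) ler_sqrt// ler1n.
have [phi [phi0 phi1 phix phi4 phiq]] := common_density q0 C0 hC.
have mphi : measurable_fun setT phi by case: phi1.
have [x xframe] := orthonormal_frame phi0 phi1 phix phi4 dimX.
have [Om [r [Om0 r1 r2 r4]]] := rademacher_system R n.
have sum_r om : \sum_(i < n) r om i ^+ 2 = n%:R.
  by rewrite (eq_bigr (fun=> 1)) => [|i _]; rewrite ?r1// sumr_const card_ord.
(* The n approximation errors then add up to at most 1 <= a before U is applied, and to at most 1 /
   p <= a / p afterwards. *)
pose eta := (p * u * n%:R)^-1.
have eta0 : 0 < eta by rewrite invr_gt0 !mulr_gt0.
have [L [e [w [e1 we wsum]]]] := L1_simple_approx n (fun i => W (x i)) eta0.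
pose f l := Lspace_fun (U (e l)).
have Ue l : `|U (e l)| <= u by rewrite (le_trans (Uu _))// ler_piMr// ltW.
have fu l : integral_le mu (fun t => `|f l t|) u.
  exact: integral_leW (integral_le_L1 _) (Ue l).
have mf l : measurable_fun setT (f l) by exact: Lspace_measurable.
have M0 : 0 < 2 ^+ q.+1 :> R by rewrite exprn_gt0.
have [[l [A [mA Adis Amass]]]|[G [mG phiG stuck]]] :=
    greedy_peaks (2 * p)^-1 mphi phi0 fu mf M0 (ltW u_gt0) m.
  by exists (e \o l), A; split=> // i; exact: e1.
exfalso.
have r_le1 om i : `|r om i| <= 1.
  by rewrite -(@ler_pXn2r _ 2)// ?nnegrE// real_normK ?num_real// r1 expr1n.
have frame_om om : `|\sum_(i < n) r om i *: x i| <= a.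
  by have [_ + _] := xframe (r om); rewrite sum_r.
pose err om := \sum_(i < n) r om i *: (W (x i) - \sum_l w i l *: e l).
have err_le om : `|err om| <= n%:R * eta.
  apply: le_trans (ler_norm_sum _ _ _) _.
  have -> : n%:R * eta = \sum_(i < n) eta by rewrite sumr_const card_ord mulr_natl.
  apply: ler_sum => i _; rewrite normrZ; apply: le_trans (we i (ltn_ord i)).
  by rewrite ler_piMl.
have errE om : err om = W (\sum_(i < n) r om i *: x i) -
    \sum_(i < n) r om i *: \sum_l w i l *: e l.
  rewrite /err linear_sum -sumrB; apply: eq_bigr => i _.
  by rewrite scalerBr [W (_ *: _)]linearZ_LR.
have wwn om : \sum_l `|\sum_(i < n) r om i * w i l| <= 2 * a.
  apply: le_trans (wsum (r om)) _.
  have -> : \sum_(i < n) r om i *: \sum_l w i l *: e l =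
      W (\sum_(i < n) r om i *: x i) - err om by rewrite errE opprB addrC subrK.
  apply: le_trans (ler_normB _ _) _.
  have := le_trans (W1 _) (frame_om om); have := err_le om.
  have : n%:R * eta <= 1.
    rewrite /eta invfM mulrC divfK ?gt_eqF// invf_le1 ?mulr_gt0//.
    by rewrite -[1]mulr1 ler_pM.
  by move: a1; clear; lra.
have feta om : integral_le mu (fun t => `|\sum_(i < n) r om i * Lspace_fun (val (x i)) t -
    \sum_l (\sum_(i < n) r om i * w i l) * f l t|) (a / p).
  have Uerr : `|U (err om)| <= a / p.
    apply: le_trans (Uu _) _; apply: (@le_trans _ _ (u * (n%:R * eta))).
      by rewrite ler_pM2l.
    rewrite [leLHS](_ : _ = p^-1); first by rewrite ler_pdivlMr// mulVf// gt_eqF.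
    by rewrite /eta; field; rewrite !gt_eqF.
  have UerrE : U (err om) = val (\sum_(i < n) r om i *: x i) +
      -1 *: \sum_l (\sum_(i < n) r om i * w i l) *: U (e l).
    rewrite errE linearB scaleN1r; congr (_ - _); first by rewrite jUW.
    have Ui (i : 'I_n) : U (r om i *: \sum_l w i l *: e l) =
        \sum_l (r om i * w i l) *: U (e l).
      rewrite [U _]linearZ_LR [U _]linear_sum scaler_sumr; apply: eq_bigr => l _.
      by rewrite [U _]linearZ_LR scalerA.
    rewrite [U _]linear_sum (eq_bigr _ (fun i _ => Ui i)) exchange_big/=.
    by apply: eq_bigr => l _; rewrite scaler_suml.
  apply: (integral_le_ae (integral_leW (integral_le_L1 _) Uerr)) => //.
    apply: measurable_fun_normr; apply: measurable_funB; apply: measurable_fun_lin => //.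
    by move=> i; exact: Lspace_measurable.
  have [_ _ yE] := xframe (r om).
  have sE := L1_lin_ae (index_enum L) (fun l => \sum_(i < n) r om i * w i l) (fun l => U (e l)).
  apply: filterS (filterI yE (filterI sE (filterI (LspaceD (val (\sum_(i < n) r om i *: x i))
    (-1 *: \sum_l (\sum_(i < n) r om i * w i l) *: U (e l)))
    (LspaceZ (-1) (\sum_l (\sum_(i < n) r om i * w i l) *: U (e l)))))) => t.
  move=> [/(_ I) E1 [/(_ I) E2 [/(_ I) E3 /(_ I) E4]]].
  by rewrite UerrE E3/= E4/= E1 E2 /GRing.scale/= mulN1r.
(* Carries a moment bound from X to pointwise combinations of the frame, with the Euclidean norm of
   the coefficients in place of the norm of X. *)
have transfer k (c : nat -> R) (b : R) : 0 <= b ->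
    (forall y : normed_subspace X, integral_le mu
      (fun t => `|Lspace_fun (val y) t| ^+ k.+1 * (phi t)^-1 ^+ k) ((b * `|y|) ^+ k.+1)) ->
    integral_le mu (fun t => `|\sum_(i < n) c i * Lspace_fun (val (x i)) t| ^+ k.+1 *
      (phi t)^-1 ^+ k) ((b * Num.sqrt (\sum_(i < n) c i ^+ 2)) ^+ k.+1).
  move=> b0 hy; have [_ y_le yE] := xframe c.
  apply: integral_leW (_ : integral_le mu _ ((b * `|\sum_(i < n) c i *: x i|) ^+ k.+1)) _; last first.
    rewrite lerXn2r ?nnegrE ?mulr_ge0 ?sqrtr_ge0//.
    by rewrite ler_wpM2l.
  apply: (integral_le_ae (hy _)).
  - apply: measurable_funM.
      apply/measurable_funX/measurable_fun_normr/measurable_fun_lin => i.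
      exact: Lspace_measurable.
    exact/measurable_funX/measurable_fun_invr.
  - by move=> t; rewrite mulr_ge0 ?exprn_ge0 ?invr_ge0.
  - by apply: filterS yE => t /(_ I) ->.
pose S : R := Num.sqrt q.+1%:R.
have S0 : 0 < S by rewrite sqrtr_gt0.
apply: (@core_numeric _ a p C u S a0 C0 u1 pE (ltW S0)).
  rewrite -[leLHS]ger0_norm; last by rewrite !mulr_ge0// ltW.
  rewrite -sqrtr_sqr ler_wsqrtr// exprMn sqr_sqrtr//.
  apply: le_trans qn; rewrite le_eqVlt; apply/orP; left; apply/eqP; ring.
rewrite a2.
apply: (@core_bound _ _ _ mu n q Om L r (fun i => Lspace_fun (val (x i))) phi G f w
  ((8 * C) ^+ 4) (4 * C * S) (p ^+ 2)^-1 u (2 * p)^-1 (a / p) (2 * a)) => //.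
- by move=> i; exact: Lspace_measurable.
- by move=> c; have [] := xframe c.
- move=> c; have C8 : 0 <= 8 * C by rewrite mulr_ge0// ltW.
  have c0 : 0 <= \sum_(i < n) c i ^+ 2 by rewrite sumr_ge0// => i _; exact: sqr_ge0.
  have sqrt4 : Num.sqrt (\sum_(i < n) c i ^+ 2) ^+ 4 = (\sum_(i < n) c i ^+ 2) ^+ 2.
    by rewrite (exprM _ 2 2) sqr_sqrtr.
  have := transfer 3 c _ C8 phi4; rewrite exprMn sqrt4.
  congr (integral_le _ _ _); apply/funext => t.
  by rewrite -normrX ger0_norm// exprn_even_ge0.
- by move=> c; apply: transfer phiq; rewrite !mulr_ge0// ltW.
- exact: integral_leW phiG mp.
- by rewrite !mulr_gt0.
- exact: ltW.
- by rewrite invr_ge0 mulr_ge0// ltW.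
- by rewrite !mulr_gt0// invr_gt0 exprn_gt0.
- by rewrite mulr_gt0.
Qed.

End Factorization.

(** * Choice of the parameters and conclusion *)

Theorem corollary12 (R : realType)
    (d : measure_display) (T : measurableType d)
    (mu : {measure set T -> \bar R})
    (n : nat) (n_gt0 : (0 < n)%N)
    (X : submodClosed (LspaceType1 mu))
    (dimX : Vector.axiom n (normed_subspace X))
    (C : R)
    (hC : forall q : R, 2 <= q ->
      (change_const_subspace q%:E X <= (C * Num.sqrt q)%:E)%E)
    (d' : measure_display) (T' : measurableType d')
    (nu : {measure set T' -> \bar R})
    (W : {linear normed_subspace X -> LspaceType1 nu})
    (U : {linear LspaceType1 nu -> LspaceType1 mu})
    (U_bounded : continuous U)
    (W_le1 : (opnorm W <= 1)%E)
    (jUW : (\val : normed_subspace X -> LspaceType1 mu) =1 U \o W) :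
  let D : R := (2 ^+ 8 * C * fine (opnorm U)) ^+ 2 in
  exists k : nat,
    5 `^ (- (2 * D)) * 2 `^ (n%:R / (2 * D)) <= k%:R /\
    (gamma_space U (ell1 R k) <= (5 `^ (2 * D))%:E)%E.
Proof.
move=> D; pose u := fine (opnorm U).
have Uu : forall z, `|U z| <= u * `|z| by exact: le_opnorm (opnorm_fin U_bounded).
have W1 x : `|W x| <= `|x|.
  have Wfin : (opnorm W < +oo)%E by apply: le_lt_trans W_le1 _; exact: ltry.
  apply: le_trans (le_opnorm Wfin x) _; rewrite ler_piMl//.
  by rewrite -lee_fin fineK// ge0_fin_numE// opnorm_ge0.
(* A nonzero vector, available as n > 0, forces u >= 1 through U W x0 = x0 and C^2 >= 1 / 2. *)
have [x0 x0_neq0] : exists x : normed_subspace X, x != 0.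
  have [v2r v2r_lin [r2v v2rK r2vK]] := dimX.
  exists (r2v (const_mx 1)); apply/eqP => c0.
  have v2r0 : v2r 0 = 0.
    have := v2r_lin 1 0 0.
    by rewrite !scale1r !addr0 => /eqP; rewrite -subr_eq0 opprD addNKr oppr_eq0 => /eqP.
  have /rowP/(_ (Ordinal n_gt0)) : const_mx 1 = 0 :> 'rV[R]_n by rewrite -[LHS]r2vK c0.
  by rewrite !mxE => /eqP; rewrite oner_eq0.
have nx0 : 0 < `|x0| by rewrite normr_gt0.
have nUW : `|U (W x0)| = `|x0| by rewrite -[U (W x0)]/((U \o W) x0) -jUW.
have u1 : 1 <= u.
  rewrite -(ler_pM2r nx0) mul1r -{1}nUW; apply: le_trans (Uu _) _.
  have u0 : 0 <= u by rewrite fine_ge0// opnorm_ge0.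
  exact: ler_wpM2l.
have u_gt0 : 0 < u by exact: lt_le_trans u1.
have C2 : 1 <= C * Num.sqrt 2 by exact: change_const_ge1 x0_neq0 (hC _ (lexx _)).
have sqrt2 : 0 < Num.sqrt 2 :> R by rewrite sqrtr_gt0.
have C0 : 0 < C by rewrite -(pmulr_lgt0 _ sqrt2); exact: lt_le_trans C2.
have CC : 2^-1 <= C ^+ 2.
  have : 1 <= (C * Num.sqrt 2) ^+ 2 by exact: exprn_ege1.
  by rewrite exprMn sqr_sqrtr//; clear; lra.
have [p pE] : exists p : R, p = 2 ^+ 12 * C ^+ 2 by exists (2 ^+ 12 * C ^+ 2).
have p1 : 1 <= p by rewrite pE; move: CC; clear; lra.
have p_gt0 : 0 < p by exact: lt_le_trans p1.
have DE : D = 16 * p * u ^+ 2 by rewrite /D -/u pE; ring.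
have uu : 1 <= u ^+ 2 by exact: exprn_ege1.
have pu : p <= p * u ^+ 2 by rewrite ler_peMr// ltW.
have D16 : 16 * p <= D by rewrite DE -mulrA; move: pu; clear; lra.
have D_gt0 : 0 < D by apply: lt_le_trans D16; rewrite mulr_gt0.
have D1 : 1 <= D by move: D16 p1; clear; lra.
have D3 := cube_le_powR5 (ltW D_gt0).
set c5 := 5 `^ (2 * D) in D3 *.
have c5_gt0 : 0 < c5 by rewrite powR_gt0.
have D_c5 : D <= c5 by apply: le_trans D3; rewrite ler_eXnr.
rewrite powRN -/c5.
set N := n%:R / (2 * D).
have D2 : 0 < 2 * D by rewrite mulr_gt0.
(* If 2^N <= 5^(2D), any k >= 1 will do: the single vector W x0 / |x0| has a peak of mass 1 on the
   whole space. *)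
have [small|large] := leP (2 `^ N) c5.
  have [k [k_gt gk]] : exists k : nat, 1%:R * (1 / (16 * u)) <= k%:R /\
      (gamma_space U (ell1 R k) <= (2 / 1)%:E)%E.
    apply: (@gamma_of_disjoint_peaks _ _ _ mu _ _ nu U 1 u 1 (fun=> `|x0|^-1 *: W x0)
      (fun=> setT)) => //.
    - move=> _; rewrite normrZ normfV normr_id ler_pdivrMl// mulr1.
      exact: W1.
    - by move=> [|i] [|j].
    - move=> i _; under eq_integral do rewrite indicT mulr1.
      rewrite -L1_normE linearZ normrZ nUW normfV normr_id mulVf// gt_eqF//.
  have k1 : (0 < k)%N.
    rewrite -(ltr_nat R); apply: lt_le_trans k_gt.
    by rewrite mul1r divr_gt0// mulr_gt0.
  exists k; split.
    by apply: (@le_trans _ _ 1); rewrite ?ler1n// ler_pdivrMl// mulr1.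
  apply: le_trans gk _; rewrite divr1 lee_fin; apply: le_trans D_c5.
  by move: D16 p1; clear; lra.
have ND : 2 * D < N.
  rewrite ltNge; apply/negP => ND; move: large; rewrite ltNge => /negP; apply.
  apply: (@le_trans _ _ (2 `^ (2 * D))); first by rewrite ler_powR// ler1n.
  by apply: ge0_ler_powR; rewrite ?nnegrE ?ler_nat// ltW.
have N0 : 0 <= N by move: ND D_gt0; clear; lra.
pose q := Num.truncn N.
have /andP[qN Nq] := truncn_itv N0.
have q0 : (0 < q)%N by rewrite truncn_gt0; move: ND D1; clear; lra.
pose M : R := 2 ^+ q.+1.
have M_gt0 : 0 < M by rewrite exprn_gt0.
have NM : 2 `^ N <= M.
  by rewrite /M -powR_mulrn// ler_powR ?ler1n// ltW.
(* The factor in brackets is D, and q + 1 <= N + 1 <= 2 N = n / D because N > 2D >= 1. *)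
have qn : q.+1%:R * (2 ^+ 16 * C ^+ 2 * u ^+ 2) <= n%:R.
  have -> : 2 ^+ 16 * C ^+ 2 * u ^+ 2 = D by rewrite DE pE; ring.
  rewrite -ler_pdivlMr// (_ : n%:R / D = 2 * N); last first.
    by rewrite /N; field; rewrite gt_eqF.
  by rewrite -natr1; move: qN ND D1; rewrite -/q; clear; lra.
have c5M : c5 <= M by apply: le_trans NM; exact: ltW.
have D3E : D ^+ 3 = 2 ^+ 12 * (p ^+ 3 * u ^+ 6) by rewrite DE; ring.
(* Up to rounding, the largest m for which the removed set has [phi]-mass at most p^-2; it is at
   least 1 as p^2 u <= D^3 <= 5^(2D) <= M. *)
pose y := M / (p ^+ 2 * u).
have y1 : 1 <= y.
  rewrite ler_pdivlMr ?mul1r; last by rewrite mulr_gt0// exprn_gt0.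
  apply: le_trans c5M; apply: le_trans D3; rewrite D3E.
  apply: (@le_trans _ _ (p ^+ 3 * u ^+ 6)).
    apply: ler_pM; rewrite ?exprn_ge0 ?(ltW p_gt0) ?(ltW u_gt0)//.
      exact: ler_weXn2l.
    exact: ler_eXnr.
  apply: ler_peMl; last by rewrite -natrX ler1n.
  by rewrite mulr_ge0 ?exprn_ge0 ?(ltW p_gt0) ?(ltW u_gt0).
pose m := Num.truncn y.
have /andP[my ym] := truncn_itv (le_trans ler01 y1).
have m1 : (0 < m)%N by rewrite truncn_gt0.
have m_half : y / 2 <= m%:R.
  have : 1 <= m%:R :> R by rewrite ler1n.
  by move: ym; rewrite -/m -natr1; clear; lra.
have mp : m%:R * (u / 2 ^+ q.+1) <= (p ^+ 2)^-1.
  rewrite -/M; apply: (@le_trans _ _ (y * (u / M))).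
    by rewrite ler_wpM2r// divr_ge0// ltW.
  rewrite le_eqVlt; apply/orP; left; apply/eqP.
  by rewrite /y; field; rewrite !gt_eqF.
have [e [A [e1 mA Adis Amass]]] :=
  exists_disjoint_peaks n_gt0 dimX C0 hC u1 Uu W1 jUW pE q0 p1 qn mp.
have dl0 : 0 < (2 * p)^-1 by rewrite invr_gt0 mulr_gt0.
have dlu : (2 * p)^-1 <= u.
  apply: le_trans u1; rewrite invf_le1 ?mulr_gt0//.
  by move: p1; clear; lra.
have [k [kb gk]] := gamma_of_disjoint_peaks Uu dl0 dlu e1 mA Adis Amass.
exists k; split.
  apply: le_trans kb.
  (* Rounding costs a factor 2, and the total loss 64 p^3 u^2 is at most D^3 = 2^12 p^3 u^6, hence
     at most 5^(2D). *)
  apply: (@le_trans _ _ (y / 2 * ((2 * p)^-1 / (16 * u)))); last first.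
    by apply: ler_wpM2r => //; rewrite divr_ge0 ?invr_ge0 ?mulr_ge0// ltW.
  have -> : y / 2 * ((2 * p)^-1 / (16 * u)) = (64 * p ^+ 3 * u ^+ 2)^-1 * M.
    by rewrite /y; field; rewrite !gt_eqF.
  have pu6 : 0 < 64 * p ^+ 3 * u ^+ 2 by rewrite !mulr_gt0// exprn_gt0.
  apply: ler_pM; rewrite ?invr_ge0 ?powR_ge0 ?(ltW c5_gt0)//.
  rewrite lef_pV2 ?posrE//; apply: le_trans D3; rewrite D3E -mulrA.
  apply: ler_pM; rewrite ?mulr_ge0 ?exprn_ge0 ?(ltW p_gt0) ?(ltW u_gt0)//.
    by rewrite -natrX ler_nat.
  by apply: ler_wpM2l; rewrite ?exprn_ge0 ?(ltW p_gt0)//; exact: ler_weXn2l.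
(* The factorization constant is 2 / dl = 4 p, which is at most D. *)
apply: le_trans gk _; rewrite lee_fin invrK; apply: le_trans D_c5.
by move: D16 p1; clear; lra.
Qed.
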